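(* Let $(a,b,m,n)\in\mathcal Q$ with $m\le n$. Assume that $F\in R_{m,n}$, $G\in R_{bm/a,\,bn/a}$, $[F,G]\in\mathbb C$, and $$\frac ba>\frac{n-m}{a}-1 .$$ Let $P$ be either the innermost polynomial $Z$ of $F$ or the inner polynomial $\zeta(F)$ of $(F,a)$, and suppose $P\neq0$. Then the NE vertex $(m',n')$ of the Newton polygon $N(P)$ coincides with the EN vertex of $N(P)$, it satisfies $m\,n'=n\,m'$ (i.e. $n'/m'=n/m$ when $m'\ne0$), and $N^0(P)\subseteq\mathrm{Rect}_{m',n'}$.
   Context: $\mathcal R=\mathbb C[x,y]$ and $[f,g]=\frac{\partial f}{\partial x}\frac{\partial g}{\partial y}-\frac{\partial f}{\partial y}\frac{\partial g}{\partial x}$. For $f=\sum f_{ij}x^iy^j\in\mathcal R$, $\mathrm{supp}(f)=\{(i,j): f_{ij}\ne0\}$, $N(f)$ is the convex hull of $\mathrm{supp}(f)$, and $N^0(f)$ is the convex hull of $\mathrm{supp}(f)\cup\{(0,0)\}$. $\mathrm{Rect}_{m,n}=[0,m]\times[0,n]\subset\mathbb R^2$. The EN vertex of a convex polygon is the one with higher $y$-coordinate among its rightmost vertices; the NE vertex is the one with larger $x$-coordinate among its uppermost vertices. For positive integers $m,n$, $R_{m,n}$ is the set of $f\in\mathcal R$ with $N^0(f)=\mathrm{Rect}_{m,n}$ and the coefficient of $x^my^n$ in $f$ equal to $1$. $\mathcal Q=\{(a,b,m,n)\in\mathbb Z_{>0}^4 : a\mid m,\ a\mid n,\ \gcd(a,b)=1,\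 2\le a<b\}$. $\mathbb T\subset\mathbb C[z]$ is the set of monic polynomials $z^k+e_{k-1}z^{k-1}+\cdots+e_0$ with $k\ge1$ and $e_{k-1}=0$. For $f\in\mathcal R$, $\mathcal W(f)=\{W\in\mathcal R : f=\alpha(W)\text{ for some }\alpha\in\mathbb T\}$; $f$ is called principal if $\mathcal W(f)=\{f\}$. Given $F\in R_{m,n}$, let $\mathcal N''=[\frac{a-1}{a}m,m]\times[\frac{a-1}{a}n,n]$. The pre-generator $Q$ of $(F,a)$ is the unique polynomial with $\mathrm{supp}(Q)\subseteq\mathrm{Rect}_{m/a,n/a}$, coefficient of $x^{m/a}y^{n/a}$ equal to $1$, and $\mathrm{supp}(F-Q^a)\cap\mathcal N''=\emptyset$. The inner polynomial of $(F,a)$ is $\zeta(F):=F-Q^a$. The $F$-generator $W_F$ is the unique principal polynomial in $\mathcal W(Q)$ such that, writing $Q=\beta(W_F)$ with $\beta\in\mathbb T$ of degree $\delta$, the coefficient of $x^{m/(a\delta)}y^{n/(a\delta)}$ in $W_F$ is $1$. Let $e_0,\dots,e_{(a-1)\delta-1}\in\mathbb C$ be the unique constants such that $$Z:=F-Q^a-\sum_{j=0}^{(a-1)\delta-1}e_jW_F^j$$ has zero coefficient at $x^{jm/(a\delta)}y^{jn/(a\delta)}$ for every integer $0\le j\le(a-1)\delta-1$. This $Z$ is the innermost polynomial of $F$. *)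

(* Defs.v *)
From HB Require Import structures.
From mathcomp Require Import all_boot all_order all_algebra.
From mathcomp Require Import all_classical all_reals.
From mathcomp Require Import convex.
From mathcomp Require Import complex.

Set Implicit Arguments.
Unset Strict Implicit.
Unset Printing Implicit Defensive.

Import Order.TTheory GRing.Theory Num.Theory.
Local Open Scope classical_set_scope.
Local Open Scope complex_scope.
Local Open Scope ring_scope.

Section BivariatePolynomials.
Context {R : realType}.

(* C[x, y], following polyXY: the outer variable is x, the inner one is y. *)
Definition bipoly := {poly {poly R[i]}}.

Implicit Types f g Q W Z : bipoly.

Definition bicoef f (i j : nat) : R[i] := f`_i`_j.

Definition biconst (c : R[i]) : bipoly := c%:P%:P.

Definition dx f : bipoly := f^`().
Definition dy f : bipoly := map_poly (@deriv R[i]) f.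
Definition jacobian f g : bipoly := dx f * dy g - dy f * dx g.

(* alpha(W) for alpha in C[z] *)
Definition evalp (alpha : {poly R[i]}) W : bipoly :=
  (map_poly (polyC \o polyC) alpha).[W].

End BivariatePolynomials.

Arguments bipoly : clear implicits.

Section NewtonPolygons.
Context {R : realType}.

(* The regular module R^o gives pairs their R-vector space structure. *)
Definition plane : lmodType R := (R^o * R^o)%type.

Definition convex_hull (A : set plane) : set plane :=
  smallest (@convex_set R plane) A.

Definition supp (f : bipoly R) : set plane :=
  [set p | exists i j : nat, bicoef f i j != 0 /\ p = (i%:R, j%:R)].

Definition newton (f : bipoly R) : set plane := convex_hull (supp f).
Definition newton0 (f : bipoly R) : set plane :=
  convex_hull (supp f `|` [set (0, 0)]).

Definition box (x0 x1 y0 y1 : R) : set plane :=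
  [set p | (x0 <= p.1 <= x1) && (y0 <= p.2 <= y1)].

Definition Rect (u v : R) : set plane := box 0 u 0 v.

(* Vertices are the extreme points; this also makes sense for polygons
   degenerating to a segment or a point. *)
Definition vertex (A : set plane) (p : plane) : Prop :=
  A p /\ forall (q r : plane) (t : R), A q -> A r -> 0 < t < 1 ->
    p = t *: q + (1 - t) *: r -> q = p /\ r = p.

Definition NE_vertex (A : set plane) (p : plane) : Prop :=
  vertex A p /\
  forall q, vertex A q -> q.2 <= p.2 /\ (q.2 = p.2 -> q.1 <= p.1).

Definition EN_vertex (A : set plane) (p : plane) : Prop :=
  vertex A p /\
  forall q, vertex A q -> q.1 <= p.1 /\ (q.1 = p.1 -> q.2 <= p.2).

End NewtonPolygons.

Arguments plane : clear implicits.

Definition quadQ (a b m n : nat) : Prop :=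
  [/\ (0 < a)%N, (0 < b)%N, (0 < m)%N & (0 < n)%N] /\
  [/\ (a %| m)%N, (a %| n)%N, coprime a b & (2 <= a < b)%N].

Section Generators.
Context {R : realType}.
Implicit Types (f F Q W Z : bipoly R) (alpha beta : {poly R[i]}).
Implicit Types a m n delta : nat.

Definition Rmn m n : set (bipoly R) :=
  [set f | newton0 f = Rect m%:R n%:R /\ bicoef f m n = 1].

(* [size alpha] is the degree plus one. *)
Definition TT : set {poly R[i]} :=
  [set alpha | [/\ alpha \is monic, (1 < size alpha)%N &
                   alpha`_(size alpha).-2 = 0]].

Definition WW f : set (bipoly R) :=
  [set W | exists2 alpha, TT alpha & f = evalp alpha W].

Definition principal f : Prop := WW f = [set f].

(* Throughout, F is meant to lie in Rmn m n with a dividing m and n. *)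
Definition pre_generator a m n F Q : Prop :=
  [/\ supp Q `<=` Rect (m %/ a)%:R (n %/ a)%:R,
      bicoef Q (m %/ a) (n %/ a) = 1 &
      supp (F - Q ^+ a) `&`
        box ((a%:R - 1) / a%:R * m%:R) m%:R ((a%:R - 1) / a%:R * n%:R) n%:R
      = set0].

Definition inner_polynomial a m n F Z : Prop :=
  exists2 Q, pre_generator a m n F Q & Z = F - Q ^+ a.

(* W is the F-generator and Q = beta(W) with beta in TT of degree delta.
   Comparing degrees in x and in y in Q = beta(W) shows that a * delta
   divides m and n, so the quotients are exact. *)
Definition generator a m n F W Q delta : Prop :=
  [/\ pre_generator a m n F Q, WW Q W, principal W &
      exists beta, [/\ TT beta, Q = evalp beta W, (size beta).-1 = delta &
        bicoef W (m %/ (a * delta)) (n %/ (a * delta)) = 1]].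

Definition innermost_polynomial a m n F Z : Prop :=
  exists W Q delta (e : 'I_(a.-1 * delta) -> R[i]),
    [/\ generator a m n F W Q delta,
        Z = F - Q ^+ a - \sum_j biconst (e j) * W ^+ j &
        forall j : 'I_(a.-1 * delta),
          bicoef Z (j * (m %/ (a * delta))) (j * (n %/ (a * delta))) = 0].

End Generators.

(* Main.v *)
From HB Require Import structures.
Require Import Defs.
From mathcomp Require Import all_boot all_order all_algebra.
From mathcomp Require Import all_classical all_reals.
From mathcomp Require Import complex.
From mathcomp Require Import convex polyXY interval_inference zify ring.

(** Write [F = B(W) + P] with [B] monic of degree [d = a delta]; for the inner
    polynomial, [W = Q] and [B = z^a].  It is enough to show that the right end
    of the top row of [P] is not above the diagonal spanned by [(m, n)], and that
    the upper end of its rightmost column is not below ([remainder_corner]): these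
    two vertices then coincide, lie on the diagonal, and dominate the support.

    Both halves are instances of [no_steep_remainder], in which one variable is
    the base, say [y], and the other one is the unknown.  Suppose that the top row
    of [P] is steep.  Follow a sequence of shrinking Newton-Puiseux discs
    [x = sigma(y) + xi y^-theta], on which [F = f(xi) y^e + ...] and
    [P = p(xi) y^eP + ...] with lower order terms in [y].  When [theta] grows, [e]
    decreases at a speed equal to the number of zeros of [F] in the disc, and [eP]
    at a speed equal to the number of zeros of [P].  By a pigeonhole
    ([root_of_small_ratio]) the discs can be chosen so that the ratio of these
    numbers never exceeds its initial value.  The steepness then forces [eP] to
    catch up with [e] while [e] is still positive.

    On the disc where this happens, [f = w^d + p] with [w] the leading coefficient
    of [W] and [p] of degree less than [(a - 1) / a] times the degree of [w^d]; this
    bound comes from the support condition that defines the pre-generator.  On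
    the other hand, as long as [(1 + b / a) e > 1 - theta], the equation
    [[F, G] = c] gives [a f g' = b f' g] for the leading coefficients, hence [g^a] is
    proportional to [f^b], and, [a] and [b] being coprime, [f] is proportional to an
    [a]-th power ([disc_powers], [power_of_coprime_power]).  But [a]-th powers of
    two polynomials cannot be that close ([power_gap]).

    The inequality [(1 + b / a) e > 1 - theta] up to the catch-up is elementary
    ([jac_vanishes_y_base], [jac_vanishes_x_base]); with base [y] it follows from [m <= n], and with
    base [x] from the lower bound on [b / a].

    The discs are kept polynomial: with [y = t^-D] all the functions are
    polynomials in [xi] and [t], up to powers of [t] that are recorded as
    natural numbers, and leading coefficients are the values at [t = 0]. *)

Set Implicit Arguments.
Unset Strict Implicit.
Unset Printing Implicit Defensive.
Import Order.TTheory GRing.Theory Num.Theory.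
Local Open Scope ring_scope.

(** * Polynomials in one variable *)

Section Univariate.
Variable C : numClosedFieldType.
Implicit Types (u v p q : {poly C}) (r : C).

Lemma deg_mul u v : u != 0 -> v != 0 ->
  (size (u * v)).-1 = ((size u).-1 + (size v).-1)%N.
Proof.
move=> u0 v0; rewrite size_mul //; move: u0 v0; rewrite -!size_poly_gt0.
by case: (size u) (size v) => [|m] [|n] // _ _; rewrite /= addnS.
Qed.

Lemma factor_mup r u : u != 0 ->
  exists2 v, ~~ root v r & u = v * ('X - r%:P) ^+ mup r u.
Proof.
move=> u0; have [k [v]] := multiplicity_XsubC u r; rewrite u0 /= => vr eu.
exists v => //; rewrite [in RHS]eu mupMr // mup_XsubCX eqxx; exact: eu.
Qed.

Lemma mupX r u k : u != 0 -> mup r (u ^+ k) = (k * mup r u)%N.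
Proof.
move=> u0; elim: k => [|k IH]; first by rewrite expr0 mupNroot ?root1.
by rewrite exprS mupM ?expf_neq0 // IH mulSn.
Qed.

Lemma mupZ r c u : c != 0 -> mup r (c *: u) = mup r u.
Proof. by move=> c0; rewrite -mul_polyC mupMr // rootC. Qed.

Lemma size_factor_mup r u v : u != 0 -> u = v * ('X - r%:P) ^+ mup r u ->
  size u = (size v + mup r u)%N.
Proof.
move=> u0 eu; have v0 : v != 0 by apply: contraNneq u0 => v0; rewrite eu v0 mul0r.
by rewrite [in LHS]eu size_Mmonic ?monic_exp ?monicXsubC // size_exp_XsubC addnS.
Qed.

Lemma mup_lt_size r u : u != 0 -> (mup r u < size u)%N.
Proof.
move=> u0; have [v _ eu] := factor_mup r u0.
have v0 : v != 0 by apply: contraNneq u0 => v0; rewrite eu v0 mul0r.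
by rewrite (size_factor_mup u0 eu) -[ltnLHS]add0n ltn_add2r size_poly_gt0.
Qed.

Lemma mup_full r u : u != 0 -> mup r u = (size u).-1 ->
  u = lead_coef u *: ('X - r%:P) ^+ mup r u.
Proof.
move=> u0 mu; have [v vr eu] := factor_mup r u0.
have su := size_factor_mup u0 eu.
have v0 : v != 0 by apply: contraNneq u0 => v0; rewrite eu v0 mul0r.
have su0 : (0 < size u)%N by rewrite size_poly_gt0.
have /size_poly1P[c c0 vc] : size v == 1%N by apply/eqP; lia.
move: eu; rewrite vc mul_polyC => eu.
suff -> : lead_coef u = c by [].
by rewrite eu lead_coefZ (monicP (monic_exp _ (monicXsubC r))) mulr1.
Qed.

(** A pigeonhole on the roots of [u]: if every root of [u] had a larger ratio
    of multiplicities than the ratio of the degrees, then stripping the roots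
    one by one would leave a polynomial [v] of negative degree.  This is what
    selects the branch that is followed in the sequence of discs below. *)
Lemma root_of_small_ratio (N K : nat) u v : u != 0 -> v != 0 ->
  (1 < size u)%N -> (N * (size v).-1 <= K * (size u).-1)%N ->
  exists2 r, root u r & (N * mup r v <= K * mup r u)%N.
Proof.
have [k] := ubnP (size u); elim: k u v => // k IH u v suk u0 v0 su le_vu.
have /closed_rootP[r ur] : size u != 1%N by rewrite gtn_eqF.
have /orP[le|gt] := leqVgt (N * mup r v) (K * mup r u); first by exists r.
have [u' u'r eu] := factor_mup r u0.
have [v' v'r ev] := factor_mup r v0.
have szu := size_factor_mup u0 eu; have szv := size_factor_mup v0 ev.
have u'0 : u' != 0 by apply: contraNneq u'r => ->; rewrite root0.
have v'0 : v' != 0 by apply: contraNneq v'r => ->; rewrite root0.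
have mu0 : (0 < mup r u)%N by rewrite -XsubC_dvd // dvdp_XsubCl.
have u's : (0 < size u')%N by rewrite size_poly_gt0.
have v's : (0 < size v')%N by rewrite size_poly_gt0.
have le' : (N * (size v').-1 + N * mup r v <= K * (size u').-1 + K * mup r u)%N.
  have -> : (N * (size v').-1 + N * mup r v = N * (size v).-1)%N.
    by rewrite -mulnDr szv; case: (size v') v's.
  suff -> : (K * (size u').-1 + K * mup r u = K * (size u).-1)%N by [].
  by rewrite -mulnDr szu; case: (size u') u's.
have su' : (1 < size u')%N.
  rewrite ltnNge; apply/negP => le1.
  have su1 : (size u').-1 = 0%N by case: (size u') le1 => [|[]].
  by move: le'; rewrite su1 muln0 add0n leqNgt (leq_trans gt) // leq_addl.
have le2 : (N * (size v').-1 <= K * (size u').-1)%N.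
  by rewrite -(leq_add2r (K * mup r u)) (leq_trans _ le') // leq_add2l ltnW.
have [|r' u'r' le''] := IH u' v' _ u'0 v'0 su' le2.
  by rewrite -ltnS (leq_trans _ suk) // szu ltnS -addn1 leq_add2l.
have rr' : r != r' by apply: contraNneq u'r => ->.
have mul_other w (w0 : w != 0) m : mup r' (w * ('X - r%:P) ^+ m) = mup r' w.
  by rewrite mupM ?expf_neq0 ?polyXsubC_eq0 // mup_XsubCX (negPf rr') addn0.
exists r'; first by rewrite eu rootM u'r'.
by rewrite eu ev !mul_other.
Qed.

Lemma lead_coef_deriv p : lead_coef p^`() = lead_coef p *+ (size p).-1.
Proof.
have [sp|sp] := leqP (size p) 1.
  rewrite (size1_polyC sp) derivC lead_coef0 lead_coefC size_polyC.
  by case: eqP => /= [->|]; rewrite ?mul0rn ?mulr0n.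
have c0 : p^`()`_(size p).-2 != 0.
  rewrite coef_deriv; case E : (size p) sp => [|[|k]] //= _.
  by rewrite mulrn_eq0 /= -[k.+1]/(k.+2.-1) -E -lead_coefE lead_coef_eq0 -size_poly_eq0 E.
have sd : size p^`() = (size p).-1.
  have p0 : p != 0 by rewrite -size_poly_gt0 ltnW.
  have := lt_size_deriv p0.
  have : ((size p).-2 < size p^`())%N.
    by rewrite ltnNge; apply: contra c0 => le; rewrite nth_default.
  by case: (size p) sp => [|[|k]] //= _ l1 l2; apply/eqP; rewrite eqn_leq l1 -ltnS l2.
rewrite !lead_coefE sd coef_deriv; case E : (size p) sp => [|[|k]] //=.
Qed.

Lemma wronskian0_size p q : p != 0 -> q != 0 ->
  p^`() * q = p * q^`() -> size p = size q.
Proof.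
move=> p0 q0 /(congr1 (@lead_coef C)); rewrite !lead_coefM !lead_coef_deriv.
rewrite mulrnAl mulrnAr => e.
have n0 : lead_coef p * lead_coef q != 0 by rewrite mulf_neq0 ?lead_coef_eq0.
have := mulrIn n0 e => e'.
by move: p0 q0; rewrite -!size_poly_gt0; lia.
Qed.

Lemma wronskian0_proportional p q : p != 0 -> q != 0 ->
  p^`() * q = p * q^`() -> p = (lead_coef p / lead_coef q) *: q.
Proof.
move=> p0 q0 e; set k := _ / _; apply/eqP; rewrite -subr_eq0; apply/negPn/negP => r0.
have spq := wronskian0_size p0 q0 e.
have : (p - k *: q)^`() * q = (p - k *: q) * q^`().
  by rewrite derivB derivZ !mulrBl e -scalerAl -scalerAl [q^`() * q]mulrC.
move/(wronskian0_size r0 q0) => sr.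
have := lead_coef_eq0 (p - k *: q); rewrite (negPf r0) lead_coefE sr coefB coefZ.
have lq : lead_coef q != 0 by rewrite lead_coef_eq0.
by rewrite -{1}spq -!lead_coefE divfK // subrr eqxx.
Qed.

Fact power_wronskian_ring (R : comNzRingType) (a b : nat) (u v u' v' x y : R) :
  (u * v') *+ a = (u' * v) *+ b ->
  (v' * x) *+ a * (u * y) = (v * x) * ((u' * y) *+ b).
Proof.
move=> e; transitivity (x * y * ((u * v') *+ a)).
  by rewrite mulrnAl mulrnAr; congr (_ *+ _); ring.
by rewrite e !mulrnAr; congr (_ *+ _); ring.
Qed.

(** The hypothesis says [a v'/v = b u'/u], that is, [v ^+ a] and [u ^+ b] have
    the same logarithmic derivative. *)
Lemma log_proportional_powers (a b : nat) u v :
  (0 < a)%N -> (0 < b)%N -> u != 0 -> v != 0 ->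
  (u * v^`()) *+ a = (u^`() * v) *+ b ->
  exists2 k, k != 0 & v ^+ a = k *: u ^+ b.
Proof.
case: a b => [|a] [|b] // _ _ u0 v0 e.
exists (lead_coef (v ^+ a.+1) / lead_coef (u ^+ b.+1)).
  by rewrite mulf_neq0 ?invr_eq0 ?lead_coef_eq0 ?expf_neq0.
apply: wronskian0_proportional; rewrite ?expf_neq0 // !deriv_exp /= !exprS.
exact: power_wronskian_ring.
Qed.

(** With [s b = t a + 1] the identity gives that [f * (f ^+ t) ^+ a] is, up to a
    constant, the [a]-th power of [g ^+ s]; so [f ^+ t] divides [g ^+ s] and the
    quotient is the wanted root. *)
Lemma power_of_coprime_power (a b : nat) (k : C) (f g : {poly C}) :
  (0 < a)%N -> (0 < b)%N -> coprime a b ->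
  k != 0 -> f != 0 -> g ^+ a = k *: f ^+ b ->
  exists (c : C) (R : {poly C}), f = c *: R ^+ a.
Proof.
move=> a0 b0 cab k0 f0 e.
have [[|s] t est _] := egcdnP a b0; first by move: est; rewrite gcdnC (eqP cab) addn1.
have est' : (s.+1 * b = t * a + 1)%N by rewrite est gcdnC (eqP cab).
have E : (g ^+ s.+1) ^+ a = k ^+ s.+1 *: (f * (f ^+ t) ^+ a).
  rewrite exprAC e exprZn -!exprM [(b * _)%N]mulnC est' -exprS addn1 //.
have dv : f ^+ t %| g ^+ s.+1.
  rewrite -(dvdp_pexp2r _ _ a0) E dvdpZr ?expf_neq0 //.
  by rewrite dvdp_mull.
move/dvdpP: dv => [R eR]; exists (k ^+ s.+1)^-1, R.
have ks0 : k ^+ s.+1 != 0 by rewrite expf_neq0.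
have ft0 : (f ^+ t) ^+ a != 0 by rewrite !expf_neq0.
apply: (mulIf ft0); apply: (scalerI ks0).
by rewrite -E eR exprMn -scalerAl scalerA divff // scale1r.
Qed.

(** After scaling, [R] and [V] have the same leading coefficient, and
    [R ^+ a - V ^+ a] is [R - V] times a sum of [a] terms with equal leading
    coefficients.  Hence two different [a]-th powers differ by a polynomial of
    degree at least [a - 1] times the degree of [V]. *)
Lemma power_gap (a : nat) (c : C) (V R p : {poly C}) : (0 < a)%N -> p != 0 ->
  ((size p).-1 < a.-1 * (size V).-1)%N -> V ^+ a + p != c *: R ^+ a.
Proof.
move=> a0 p0 sp; apply/eqP => e.
have V0 : (1 < size V)%N by move: sp; case: (size V) => [|[|]] //; rewrite muln0.
have V0' : V != 0 by rewrite -size_poly_gt0; lia.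
have sVa : (size (V ^+ a)).-1 = ((size V).-1 * a)%N by rewrite size_exp.
have lt : (size p < size (V ^+ a))%N.
  have : (a.-1 * (size V).-1 <= (size V).-1 * a)%N by rewrite mulnC leq_mul2l leq_pred orbT.
  have : (0 < size (V ^+ a))%N by rewrite size_poly_gt0 expf_neq0.
  by have : (0 < size p)%N; [rewrite size_poly_gt0 | lia].
have lf : lead_coef (V ^+ a + p) = lead_coef V ^+ a by rewrite lead_coefDl // lead_coef_exp.
have szf : size (V ^+ a + p) = size (V ^+ a) by rewrite size_polyDl.
have f0 : V ^+ a + p != 0 by rewrite -size_poly_gt0 szf; lia.
have c0 : c != 0 by apply: contraNneq f0 => c0; rewrite e c0 scale0r.
have R0 : R != 0.
  by apply: contraNneq f0 => R0; rewrite e R0 expr0n gtn_eqF // scaler0.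
pose S := (lead_coef V / lead_coef R) *: R.
have lR : lead_coef R != 0 by rewrite lead_coef_eq0.
have lV : lead_coef V != 0 by rewrite lead_coef_eq0.
have lS : lead_coef S = lead_coef V by rewrite lead_coefZ divfK.
have eS : V ^+ a + p = S ^+ a.
  rewrite exprZn e; congr (_ *: _).
  by rewrite expr_div_n -lf e lead_coefZ lead_coef_exp mulfK ?expf_neq0.
have S0 : S != 0 by rewrite -lead_coef_eq0 lS.
have szS : size S = size V.
  have : (size (S ^+ a)).-1 = (size (V ^+ a)).-1 by rewrite -eS szf.
  rewrite !size_exp => /eqP; rewrite eqn_pmul2r // => /eqP e1.
  by rewrite -(prednK (ltnW V0)) -e1 prednK // size_poly_gt0.
have ep : p = (S - V) * \sum_(i < a) S ^+ (a.-1 - i) * V ^+ i.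
  by rewrite -subrXX -eS addrC addKr.
set T := \sum_(i < a) _ in ep.
have coT : T`_(a.-1 * (size V).-1) = lead_coef V ^+ a.-1 *+ a.
  rewrite coef_sum -[a in RHS]card_ord -sumr_const; apply: eq_bigr => i _.
  have se : (size (S ^+ (a.-1 - i) * V ^+ i)).-1 = (a.-1 * (size V).-1)%N.
    rewrite deg_mul ?expf_neq0 // !size_exp szS -mulnDr subnK 1?mulnC //.
    by rewrite -ltnS prednK.
  rewrite -se -lead_coefE lead_coefM !lead_coef_exp lS -exprD subnK ?card_ord //.
  by rewrite -ltnS prednK.
have T0 : (a.-1 * (size V).-1 < size T)%N.
  rewrite ltnNge; apply/negP => /leq_sizeP/(_ _ (leqnn _)); rewrite coT => /eqP.
  by rewrite mulrn_eq0 gtn_eqF //= (negPf (expf_neq0 _ lV)).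
have SV0 : S - V != 0 by apply: contraNneq p0 => SV; rewrite ep SV mul0r.
have T0' : T != 0 by rewrite -size_poly_gt0 (leq_ltn_trans _ T0).
move: sp; rewrite ep deg_mul // ltnNge; apply/negP/negPn.
by rewrite (leq_trans _ (leq_addl _ _)) // -ltnS prednK // size_poly_gt0.
Qed.

End Univariate.

(** * Zooming into a disc *)

Section Zoom.
Variable C : numClosedFieldType.
Local Notation bpoly := {poly {poly C}}.
Implicit Types (f g u : bpoly) (r : C).

Definition tpow k : bpoly := ('X^k)%:P.

(** An element of [{poly {poly C}}] is read as a polynomial in the coordinate
    [xi] of a disc with coefficients in [C[t]]; putting [t = 0] extracts its
    leading coefficient on the disc, because the negative powers of [t] that
    are the orders of growth are divided out. *)
Definition lead0 : bpoly -> {poly C} := map_poly (horner_eval 0).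
HB.instance Definition _ := GRing.RMorphism.copy lead0 (map_poly (horner_eval 0)).

Lemma coef_lead0 f k : (lead0 f)`_k = f`_k`_0.
Proof. by rewrite coef_map /= horner_evalE horner_coef0. Qed.

Lemma tpowD k l : tpow (k + l) = tpow k * tpow l.
Proof. by rewrite /tpow exprD polyCM. Qed.

Lemma tpow0 : tpow 0 = 1. Proof. by rewrite /tpow expr0. Qed.

Lemma tpowX k l : tpow k ^+ l = tpow (k * l).
Proof. by rewrite /tpow -polyC_exp exprM. Qed.

Lemma tpow_neq0 k : tpow k != 0.
Proof. by rewrite polyC_eq0 expf_neq0 ?polyX_eq0. Qed.

Lemma lead0_tpow k : lead0 (tpow k) = (k == 0)%:R.
Proof.
by rewrite /lead0 /tpow map_polyC /= horner_evalE hornerXn expr0n; case: k.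
Qed.

(** The derivation [t d/dt]. *)
Definition teuler f : bpoly := map_poly (fun a => 'X * a^`()) f.

Lemma coef_teuler f k : (teuler f)`_k = 'X * (f`_k)^`().
Proof. by rewrite coef_map_id0 // deriv0 mulr0. Qed.

Lemma teulerD f g : teuler (f + g) = teuler f + teuler g.
Proof. by apply/polyP => k; rewrite !(coefD, coef_teuler) derivD mulrDr. Qed.

Lemma teulerM f g : teuler (f * g) = teuler f * g + f * teuler g.
Proof.
apply/polyP => k; rewrite coef_teuler coefD !coefM raddf_sum mulr_sumr -big_split /=.
by apply: eq_bigr => i _; rewrite !coef_teuler derivM; ring.
Qed.

Lemma teulerC (c : {poly C}) : teuler c%:P = ('X * c^`())%:P.
Proof.
by apply/polyP => k; rewrite coef_teuler !coefC; case: eqP; rewrite // deriv0 mulr0.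
Qed.

Lemma teulerX : teuler 'X = 0.
Proof.
apply/polyP => k; rewrite coef_teuler coefX coef0.
by case: eqP => _; rewrite ?(derivC, deriv0, mulr0) // -[1%:R]polyC1 derivC mulr0.
Qed.

Lemma teuler_tpow k : teuler (tpow k) = tpow k *+ k.
Proof.
rewrite teulerC derivXn mulrnAr -exprS; case: k => [|k]; first by rewrite !mulr0n.
by rewrite polyCMn.
Qed.

Lemma teuler_comp f u : teuler (f \Po u) = teuler f \Po u + (f^`() \Po u) * teuler u.
Proof.
elim/poly_ind: f => [|p c IH].
  by rewrite deriv0 !comp_poly0 mul0r addr0 /teuler map_poly0 comp_poly0.
rewrite !(comp_polyD, comp_polyM, comp_polyX, comp_polyC, teulerD, teulerM, teulerX, teulerC).
rewrite derivD derivM derivC derivX IH mulr0 mulr1 !addr0.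
by rewrite !(comp_polyD, comp_polyM, comp_polyX, comp_polyC); ring.
Qed.

Lemma lead0_teuler f : lead0 (teuler f) = 0.
Proof. by apply/polyP => k; rewrite coef_lead0 coef_teuler coefXM coef0. Qed.

Lemma lead0_deriv f : lead0 f^`() = (lead0 f)^`().
Proof. by rewrite /lead0 deriv_map. Qed.

Definition ramify q : bpoly -> bpoly := map_poly (comp_poly 'X^q).
HB.instance Definition _ q := GRing.RMorphism.copy (ramify q) (map_poly (comp_poly 'X^q)).

Lemma coef_ramify q f k : (ramify q f)`_k = f`_k \Po 'X^q.
Proof. by rewrite coef_map. Qed.

Lemma teuler_ramify q f : (0 < q)%N -> teuler (ramify q f) = ramify q (teuler f) *+ q.
Proof.
case: q => // q _; apply/polyP => k; rewrite coefMn !(coef_teuler, coef_ramify).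
rewrite deriv_comp derivXn comp_polyM comp_polyX /= exprS.
by rewrite !mulrnAr; congr (_ *+ _); ring.
Qed.

Lemma deriv_ramify q f : (ramify q f)^`() = ramify q f^`().
Proof. by rewrite /ramify deriv_map. Qed.

(** [zoom q h r] substitutes [t^q] for [t], and [r + t^h xi] for [xi]: it passes
    to the disc of relative radius [h / q] around [r]. *)
Definition zoomer h r : bpoly := r%:P%:P + tpow h * 'X.
Definition zoom q h r : bpoly -> bpoly := comp_poly (zoomer h r) \o ramify q.
HB.instance Definition _ q h r :=
  GRing.RMorphism.copy (zoom q h r) (comp_poly (zoomer h r) \o ramify q).

Lemma zoom_tpow q h r k : zoom q h r (tpow k) = tpow (q * k).
Proof.
rewrite /zoom /= /ramify /tpow map_polyC /= comp_polyC.
by rewrite rmorphXn /= comp_polyX -exprM.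
Qed.

Lemma zoom_const q h r (c : C) : zoom q h r c%:P%:P = c%:P%:P.
Proof. by rewrite /zoom /= /ramify map_polyC /= !comp_polyC. Qed.

Lemma deriv_zoom q h r f : (zoom q h r f)^`() = tpow h * zoom q h r f^`().
Proof.
rewrite /zoom /= deriv_comp deriv_ramify mulrC; congr (_ * _).
by rewrite /zoomer derivD derivC derivM derivC mul0r derivX mulr1 !add0r.
Qed.

Lemma teuler_zoom q h r f : (0 < q)%N ->
  teuler (zoom q h r f) =
  zoom q h r (teuler f) *+ q + zoom q h r f^`() * (tpow h * 'X) *+ h.
Proof.
move=> q0; rewrite /zoom /= teuler_comp teuler_ramify // deriv_ramify raddfMn /=; congr (_ + _).
rewrite /zoomer teulerD teulerC derivC mulr0 add0r teulerM teulerX mulr0 addr0 teuler_tpow.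
by rewrite mulrnAl mulrnAr.
Qed.

(** Up to a power of [t], this is the Jacobian of [t^-A f] and [t^-B g] with
    respect to [xi] and [t]. *)
Definition wjac A B f g : bpoly :=
  (f * g^`()) *+ A - (f^`() * g) *+ B + (f^`() * teuler g - teuler f * g^`()).

Lemma wjac_zoom q h r A B f g : (0 < q)%N ->
  wjac (q * A) (q * B) (zoom q h r f) (zoom q h r g) =
  (tpow h * zoom q h r (wjac A B f g)) *+ q.
Proof.
move=> q0; rewrite /wjac !deriv_zoom !teuler_zoom //.
rewrite !(rmorphB, rmorphD, rmorphM, rmorphMn) /=.
move: (zoom q h r f) (zoom q h r g) (zoom q h r (teuler f)) (zoom q h r (teuler g))
  (zoom q h r f^`()) (zoom q h r g^`()) (tpow h) => F G F1 G1 F2 G2 T.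
ring.
Qed.

Lemma wjac_tpow A B mu nu f g :
  wjac (A + mu) (B + nu) (tpow mu * f) (tpow nu * g) = tpow (mu + nu) * wjac A B f g.
Proof.
rewrite /wjac !teulerM !derivM !derivC !mul0r !add0r !teuler_tpow tpowD !mulrnDr.
move: (teuler f) (teuler g) f^`() g^`() (tpow mu) (tpow nu) => F1 G1 F2 G2 T S.
ring.
Qed.

End Zoom.

(** * Newton polygons and zooms *)

Section NewtonPolygon.
Variable C : numClosedFieldType.
Local Notation bpoly := {poly {poly C}}.
Implicit Types (f g u : bpoly) (r : C).

Definition recenter r f : bpoly := f \Po ('X + r%:P%:P).

Lemma lead0_recenter r f : lead0 (recenter r f) = lead0 f \Po ('X + r%:P).
Proof.
by rewrite /recenter /lead0 map_comp_poly rmorphD /= map_polyX map_polyC /= horner_evalE hornerC.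
Qed.

Lemma coef_comp_scale (c : {poly C}) f k : (f \Po (c%:P * 'X))`_k = f`_k * c ^+ k.
Proof.
rewrite comp_polyE coef_sum.
under eq_bigr => i _ do rewrite coefZ exprMn -polyC_exp coefCM coefXn.
have [lek|ltk] := leqP (size f) k.
  rewrite nth_default // mul0r big1 // => i _.
  by rewrite (gtn_eqF (leq_trans (ltn_ord i) lek)) !mulr0.
rewrite (bigD1 (Ordinal ltk)) //= eqxx mulr1 big1 ?addr0 // => i ik.
by move: ik; rewrite -val_eqE /= eq_sym => /negPf ->; rewrite !mulr0.
Qed.

Lemma coef_zoom q h r f k :
  (zoom q h r f)`_k = ((recenter r f)`_k \Po 'X^q) * 'X^(h * k).
Proof.
have -> : zoom q h r f = ramify q (recenter r f) \Po (tpow C h * 'X).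
  rewrite /zoom /= /recenter /ramify map_comp_poly rmorphD /= map_polyX map_polyC /= comp_polyC.
  by rewrite -comp_polyA comp_polyD comp_polyX comp_polyC addrC.
by rewrite coef_comp_scale coef_ramify exprM.
Qed.

(** The Newton polygon of [f] at [r] lies on or above the line of slope
    [- h / q] through [(mu, 0)]. *)
Definition above_slope q h mu r f := forall k j, (k < mu)%N ->
  (recenter r f)`_k`_j != 0 -> (h * (mu - k) <= q * j)%N.

(** The terms of [zoom q h r f] of exponent [h * mu] in [t] are those on the line
    of slope [h / q] through [(mu, 0)]; no term lies below that line. *)
Lemma zoom_factor q h mu r f : (0 < q)%N -> (0 < h)%N -> above_slope q h mu r f ->
  exists2 f1, zoom q h r f = tpow C (h * mu) * f1 &
  forall k, (lead0 f1)`_k =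
    if ((k <= mu) && (q %| h * (mu - k)))%N then
      (recenter r f)`_k`_(h * (mu - k) %/ q)%N else 0.
Proof.
move=> q0 h0 sl; set a := recenter r f in sl *.
have cz k j : (zoom q h r f)`_k`_j =
    if ((h * k <= j) && (q %| j - h * k))%N then a`_k`_((j - h * k) %/ q)%N else 0.
  rewrite coef_zoom coefMXn coef_comp_poly_Xn //.
  by case: leqP => //=.
exists (map_poly (drop_poly (h * mu)) (zoom q h r f)).
  apply/polyP => k; rewrite coefCM coef_map /=.
  rewrite -[LHS](poly_take_drop (h * mu)) mulrC; apply/esym; rewrite -[LHS]add0r; congr (_ + _).
  apply/polyP => j; rewrite coef0 coef_take_poly; case: ltnP => // ltj.
  rewrite cz; case: ifP => // /andP[lej dq].
  apply/esym/eqP; apply: contraLR ltj => aj; rewrite -leqNgt.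
  have [km|mk] := ltnP k mu; last by rewrite (leq_trans _ lej) // leq_mul2l mk orbT.
  have := sl k _ km aj; rewrite mulnC [in X in _ -> X]mulnC [(q * _)%N]mulnC divnK // mulnBl.
  by rewrite leq_subLR [(k * h)%N]mulnC subnKC.
move=> k; rewrite coef_lead0 coef_map /= coef_drop_poly add0n cz leq_pmul2l // -mulnBr.
by [].
Qed.

Lemma recenter_low r f mu : lead0 f != 0 -> mup r (lead0 f) = mu ->
  (forall k, (k < mu)%N -> (recenter r f)`_k`_0 = 0) /\ (recenter r f)`_mu`_0 != 0.
Proof.
move=> f0 emu; have [v vr ev] := factor_mup r f0; rewrite emu in ev.
have cf k : (recenter r f)`_k`_0 = ((v \Po ('X + r%:P)) * 'X^mu)`_k.
  rewrite -coef_lead0 lead0_recenter ev comp_polyM rmorphXn /= comp_polyB comp_polyX comp_polyC.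
  by rewrite addrK.
split=> [k lk|]; first by rewrite cf coefMXn lk.
by rewrite cf coefMXn ltnn subnn -horner_coef0 horner_comp !hornerE.
Qed.

(** The pairs [(o, l)] are the horizontal and vertical distances from [(mu, 0)]
    to the points of the Newton polygon at [r], so that [o / l] runs over the
    candidate slopes. *)
Lemma slopes r f mu : lead0 f != 0 -> mup r (lead0 f) = mu ->
  exists s : seq (nat * nat),
  (forall k j, (k < mu)%N -> (recenter r f)`_k`_j != 0 -> (j, mu - k)%N \in s) /\
  (forall o l, (o, l) \in s -> [/\ (0 < o)%N, (0 < l)%N &
     exists2 k, (k < mu)%N & l = (mu - k)%N /\ (recenter r f)`_k`_o != 0]).
Proof.
move=> f0 emu; have [low _] := recenter_low f0 emu; set a := recenter r f in low *.
exists (flatten [seq [seq (j, mu - k)%N | j <- iota 0 (size a`_k) & a`_k`_j != 0]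
  | k <- iota 0 mu]).
split=> [k j km akj | o l /flatten_mapP[k]].
  apply/flatten_mapP; exists k; first by rewrite mem_iota.
  apply/mapP; exists j => //; rewrite mem_filter akj mem_iota /= add0n ltnNge.
  by apply: contra akj => le; rewrite nth_default.
rewrite mem_iota add0n => /andP[_ km] /mapP[j]; rewrite mem_filter => /andP[akj _] [-> ->].
split; [|by rewrite subn_gt0|by exists k].
by rewrite lt0n; apply: contra akj => /eqP ->; rewrite low.
Qed.

Lemma min_slope (s : seq (nat * nat)) x0 : (forall x, x \in x0 :: s -> 0 < x.2)%N ->
  exists2 x, x \in x0 :: s & forall y, y \in x0 :: s -> (x.1 * y.2 <= y.1 * x.2)%N.
Proof.
elim: s x0 => [|x1 s IH] x0 pos.
  by exists x0; rewrite ?mem_head // => y; rewrite inE => /eqP ->.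
have [x xs xmin] : exists2 x, x \in x1 :: s & forall y, y \in x1 :: s -> (x.1 * y.2 <= y.1 * x.2)%N.
  by apply: IH => x xs; apply: pos; rewrite inE xs orbT.
have /orP[le|le] := leq_total (x0.1 * x.2) (x.1 * x0.2); last first.
  exists x; first by rewrite inE xs orbT.
  by move=> y; rewrite inE => /orP[/eqP -> //|/xmin].
exists x0; first exact: mem_head.
move=> y; rewrite inE => /orP[/eqP -> //|/xmin le'].
have px : (0 < x.2)%N by apply: pos; rewrite inE xs orbT.
rewrite -(leq_pmul2r px); move: le le'.
move: x0.1 x0.2 x.1 x.2 y.1 y.2 px => A B E F G H px le le'.
apply: (@leq_trans (E * B * H)); first by rewrite mulnAC leq_mul2r le orbT.
by rewrite mulnAC [(G * B * F)%N]mulnAC leq_mul2r le' orbT.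
Qed.

End NewtonPolygon.

Section Aux.
Variable C : numClosedFieldType.
Local Notation bpoly := {poly {poly C}}.

Lemma coef_XsubC_exp (r : C) n : (('X - r%:P) ^+ n.+1)`_n = - r *+ n.+1.
Proof.
elim: n => [|n IH]; first by rewrite expr1 coefB coefX coefC /= sub0r.
have l1 : (('X - r%:P) ^+ n.+1)`_n.+1 = 1.
  have /monicP := monic_exp n.+1 (monicXsubC r).
  by rewrite lead_coefE size_exp_XsubC.
by rewrite exprS mulrBl coefB coefXM coefCM /= IH l1 mulr1 [RHS]mulrS addrC.
Qed.

Lemma coef_full_mup0 (u : {poly C}) k : u != 0 -> mup 0 u = (size u).-1 ->
  (k < (size u).-1)%N -> u`_k = 0.
Proof.
move=> u0 mu lk; rewrite (mup_full u0 mu) subr0 coefZ coefXn mu.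
by rewrite ltn_eqF // mulr0.
Qed.

(** The radius is small enough for the disc to contain no other root of [lead0 f]
    than [r], and large enough for it to contain all the roots of [f] that
    reduce to [r]; so the new leading coefficient has the multiplicity of [r]
    as its degree. *)
Lemma zoom_lead0 q h r (f : bpoly) mu : (0 < q)%N -> (0 < h)%N ->
  lead0 f != 0 -> mup r (lead0 f) = mu -> above_slope q h mu r f ->
  exists f1, [/\ zoom q h r f = tpow C (h * mu) * f1, size (lead0 f1) = mu.+1 &
  forall k, (lead0 f1)`_k =
    if ((k <= mu) && (q %| h * (mu - k)))%N then
      (recenter r f)`_k`_(h * (mu - k) %/ q)%N else 0].
Proof.
move=> q0 h0 f0 emu sl; have [f1 e1 c1] := zoom_factor q0 h0 sl.
have [_ top] := recenter_low f0 emu.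
exists f1; split=> //; apply/eqP; rewrite eqn_leq; apply/andP; split.
  by apply/leq_sizeP => j lj; rewrite c1 leqNgt lj.
rewrite ltnNge; apply/negP => /leq_sizeP/(_ _ (leqnn _))/eqP.
by rewrite c1 leqnn subnn muln0 dvdn0 div0n (negPf top).
Qed.

End Aux.

(** * Discs and the Jacobian condition *)

Section Discs.
Variable C : numClosedFieldType.
Local Notation bpoly := {poly {poly C}}.
Variables (a b delta N i0 e0 Del : nat) (beta : {poly C}).
Let d := (a * delta)%N.
Hypotheses (a0 : (0 < a)%N) (b0 : (0 < b)%N) (cab : coprime a b).
Hypotheses (delta0 : (0 < delta)%N) (beta_top : beta`_d = 1).
Hypotheses (i0N : (a * i0 < a.-1 * N)%N) (Del0 : (0 < Del)%N).
(* In a disc where F grows like y ^ (A / D) and whose radius is y ^ - (Th / D),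
   the Jacobian of the leading terms of F and G vanishes as soon as
   (1 + b / a) A > D - Th.  The premises are invariants of the discs. *)
Hypothesis jac_vanishes : forall A D Th, (0 < D)%N -> (i0 * A + Del * D <= N * A)%N ->
  (e0 * D <= A + N * Th)%N -> (a * D < (a + b) * A + a * Th)%N.

(** [beta(W)] for [W = t^-om w], multiplied by [t^(d om)]. *)
Definition homog om (w : bpoly) : bpoly :=
  \sum_(k < d.+1) (beta`_k)%:P%:P * tpow C ((d - k) * om) * w ^+ k.

Definition disc_F (w p : bpoly) om gam := homog om w + tpow C gam * p.

(** The state reached after some zooms, with base variable [y = t^-D] and
    [x = sigma(t) + t^Th xi].  On this disc [W], [P], [G] and [F] are [w], [p], [g]
    and [disc_F w p om gam] times [t] to the power [-om], [gam - d om], [-eg] and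
    [-d om], so [gam] is the delay of [P] with respect to [F].
    - [disc_ratio]: [P] has few zeros on the disc in comparison with [W];
    - [disc_gap]: the quantity [N eP - i0 e], for the orders [e] and [eP] of [F]
      and [P], has not decreased since the first disc, where it is [Del];
    - [disc_rad]: [F] has at most [N] zeros on every disc met so far, hence its
      order is at least [e0 - N theta], where [theta = Th / D];
    - [disc_jac]: the Jacobian of [F] and [G] is constant. *)
Record disc (w p g : bpoly) (om gam eg s D Th : nat) (c : C) : Prop := Disc {
  disc_w0 : lead0 w != 0;
  disc_p0 : lead0 p != 0;
  disc_g0 : lead0 g != 0;
  disc_deg : (1 < size (lead0 w))%N;
  disc_ratio : (N * (size (lead0 p)).-1 <= i0 * d * (size (lead0 w)).-1)%N;
  disc_le : (d * (size (lead0 w)).-1 <= N)%N;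
  disc_D : (0 < D)%N;
  disc_eg : (a * eg = b * (d * om))%N;
  disc_gap : (N * gam + i0 * (d * om) + Del * D <= N * (d * om))%N;
  disc_rad : (e0 * D <= d * om + N * Th)%N;
  disc_s : (s + D = d * om + eg + Th)%N;
  disc_jac : wjac (d * om) eg (disc_F w p om gam) g = c%:P%:P * tpow C s
}.

Lemma d_gt0 : (0 < d)%N. Proof. by rewrite muln_gt0 a0. Qed.

Lemma i0_lt_N : (i0 < N)%N.
Proof. by rewrite -(ltn_pmul2l a0) (leq_trans i0N) // leq_mul2r leq_pred orbT. Qed.

Section OneDisc.
Variables (w p g : bpoly) (om gam eg s D Th : nat) (c : C).
Hypothesis dsc : disc w p g om gam eg s D Th c.

Lemma disc_om_gt0 : (0 < om)%N.
Proof.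
have := disc_gap dsc; rewrite lt0n; apply: contraL => /eqP ->.
by rewrite !muln0 -ltnNge addn0 addn_gt0 !muln_gt0 Del0 (disc_D dsc) orbT.
Qed.

Lemma disc_A_gt0 : (0 < d * om)%N.
Proof. by rewrite muln_gt0 d_gt0 disc_om_gt0. Qed.

Lemma disc_s_gt0 : (0 < s)%N.
Proof.
have gap : (i0 * (d * om) + Del * D <= N * (d * om))%N.
  by rewrite (leq_trans _ (disc_gap dsc)) // -addnA leq_addl.
have := jac_vanishes (disc_D dsc) gap (disc_rad dsc).
rewrite mulnDl -(disc_eg dsc) -!mulnDr -(disc_s dsc) ltn_pmul2l // -addn1.
by rewrite [(s + D)%N]addnC leq_add2l.
Qed.

Lemma lead0_homog : lead0 (homog om w) = lead0 w ^+ d.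
Proof.
rewrite rmorph_sum /= big_ord_recr /= big1 ?add0r => [|k _].
  rewrite !rmorphM rmorphXn /= subnn mul0n lead0_tpow eqxx mulr1 beta_top.
  by rewrite !rmorph1 mul1r.
rewrite !rmorphM /= lead0_tpow muln_eq0 subn_eq0 leqNgt ltn_ord /=.
by rewrite (gtn_eqF disc_om_gt0) mulr0 mul0r.
Qed.

Lemma lead0_disc_F : lead0 (disc_F w p om gam) = lead0 w ^+ d + (gam == 0%N)%:R * lead0 p.
Proof. by rewrite rmorphD rmorphM /= lead0_homog lead0_tpow. Qed.

Lemma disc_degp_small :
  ((size (lead0 p)).-1 < a.-1 * (size (lead0 w ^+ delta)).-1)%N.
Proof.
have mu0 : (0 < (size (lead0 w)).-1)%N by case: (size _) (disc_deg dsc) => [|[]].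
have N0 : (0 < N)%N by rewrite (leq_ltn_trans _ i0_lt_N).
rewrite size_exp -(ltn_pmul2l a0) -(ltn_pmul2l N0).
have := disc_ratio dsc; move: (size (lead0 w)).-1 (size (lead0 p)).-1 mu0 => mu i mu0 le.
apply: (@leq_ltn_trans (a * (i0 * d * mu))); first by rewrite mulnCA leq_mul2l le orbT.
have dmu : (0 < d * mu)%N by rewrite muln_gt0 d_gt0.
rewrite -mulnA mulnA (_ : N * _ = a.-1 * N * (d * mu))%N ?ltn_pmul2r //.
by rewrite /d; ring.
Qed.

Lemma lead0_disc_F_neq0 : lead0 (disc_F w p om gam) != 0.
Proof.
rewrite lead0_disc_F; have [_|_] := eqVneq gam 0%N; last first.
  by rewrite mul0r addr0 expf_neq0 // (disc_w0 dsc).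
rewrite mul1r; have := disc_degp_small => lt.
have lt' : (size (lead0 p) < size (lead0 w ^+ d))%N.
  have w0 := disc_w0 dsc.
  have pw : (0 < size (lead0 w ^+ d))%N by rewrite size_poly_gt0 expf_neq0.
  have pp : (0 < size (lead0 p))%N by rewrite size_poly_gt0 (disc_p0 dsc).
  rewrite -(prednK pw) -(prednK pp) ltnS size_exp (leq_trans lt) // size_exp /d.
  rewrite mulnCA leq_mul2l [(a * delta)%N]mulnC mulnC leq_mul2l leq_pred !orbT //.
by rewrite -size_poly_gt0 size_polyDl // size_poly_gt0 expf_neq0 // (disc_w0 dsc).
Qed.

(** At [t = 0] the Jacobian identity becomes [a f g' = b f' g] for the leading
    coefficients [f] and [g] of [F] and [G]. *)
Lemma disc_powers : exists2 k, k != 0 &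
  lead0 g ^+ a = k *: lead0 (disc_F w p om gam) ^+ b.
Proof.
apply: (log_proportional_powers a0 b0 lead0_disc_F_neq0 (disc_g0 dsc)).
have := congr1 (@lead0 C) (disc_jac dsc); move: (disc_F w p om gam) => F.
rewrite rmorphM /= lead0_tpow (gtn_eqF disc_s_gt0) mulr0 /wjac.
rewrite rmorphD 2!rmorphB 2!rmorphMn 4!rmorphM /= !lead0_teuler !lead0_deriv.
rewrite mulr0 mul0r subr0 addr0 => /eqP; rewrite subr_eq0 => /eqP e.
have A0 : (d * om)%:R != 0 :> C by rewrite pnatr_eq0 -lt0n disc_A_gt0.
apply: (scalerI A0); rewrite !scaler_nat -!mulrnA.
by rewrite [(a * _)%N]mulnC mulrnA e -mulrnA [(eg * a)%N]mulnC (disc_eg dsc).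
Qed.

(** If [P] had the order of [F], the leading coefficient of [F] would be
    [lead0 w ^+ d + lead0 p], which is too close to an [a]-th power to be another
    one. *)
Lemma disc_no_catch_up : gam != 0%N.
Proof.
apply/eqP => g0; have [k k0 e] := disc_powers.
have [c' [R eR]] := power_of_coprime_power a0 b0 cab k0 lead0_disc_F_neq0 e.
have := power_gap c' R a0 (disc_p0 dsc) disc_degp_small.
by rewrite -exprM [(delta * a)%N]mulnC -eR lead0_disc_F g0 eqxx mul1r eqxx.
Qed.

Lemma disc_mup_g r : (a * mup r (lead0 g) = b * (d * mup r (lead0 w)))%N.
Proof.
have [k k0 e] := disc_powers.
have := congr1 (mup r) e; rewrite mupZ // !mupX ?(disc_g0 dsc) ?lead0_disc_F_neq0 //.
rewrite lead0_disc_F (negPf disc_no_catch_up) mul0r addr0 mupX //.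
exact: (disc_w0 dsc).
Qed.

(** The radius [h / q] must not exceed the distance to the first event: a
    splitting of the zeros of [W], [P] or [G] near [r], or the catch-up of [P]. *)
Lemma disc_zoom q h r : (0 < q)%N -> (0 < h)%N -> root (lead0 w) r ->
  let mu := mup r (lead0 w) in let i := mup r (lead0 p) in let mg := mup r (lead0 g) in
  (N * i <= i0 * d * mu)%N ->
  above_slope q h mu r w -> above_slope q h i r p -> above_slope q h mg r g ->
  (h * (d * mu - i) <= q * gam)%N ->
  exists w1 p1 g1 s1,
    disc w1 p1 g1 (q * om - h * mu) (q * gam - h * (d * mu - i)) (q * eg - h * mg)
      s1 (q * D) (q * Th + h) (c *+ q)
    /\ [/\ size (lead0 w1) = mu.+1, size (lead0 p1) = i.+1, size (lead0 g1) = mg.+1 &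
    [/\ forall k, (lead0 w1)`_k = if ((k <= mu) && (q %| h * (mu - k)))%N then
         (recenter r w)`_k`_(h * (mu - k) %/ q)%N else 0,
        forall k, (lead0 p1)`_k = if ((k <= i) && (q %| h * (i - k)))%N then
         (recenter r p)`_k`_(h * (i - k) %/ q)%N else 0 &
        forall k, (lead0 g1)`_k = if ((k <= mg) && (q %| h * (mg - k)))%N then
         (recenter r g)`_k`_(h * (mg - k) %/ q)%N else 0]].
Proof.
move=> q0 h0 wr mu i mg ratio slw slp slg gap.
have [w1 [ew sw cw]] := zoom_lead0 q0 h0 (disc_w0 dsc) erefl slw.
have [p1 [ep sp cp]] := zoom_lead0 q0 h0 (disc_p0 dsc) erefl slp.
have [g1 [eg1 sg cg]] := zoom_lead0 q0 h0 (disc_g0 dsc) erefl slg.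
have mu0 : (0 < mu)%N by rewrite -XsubC_dvd ?(disc_w0 dsc) // dvdp_XsubCl.
have le_mu : (mu <= (size (lead0 w)).-1)%N.
  by rewrite -ltnS (leq_trans (mup_lt_size r (disc_w0 dsc))) // leqSpred.
have iN := i0_lt_N.
have le_i : (i <= d * mu)%N.
  have N0 : (0 < N)%N by rewrite (leq_ltn_trans _ iN).
  by rewrite -(leq_pmul2l N0) (leq_trans ratio) // -mulnA leq_mul2r (ltnW iN) orbT.
(* Transporting disc_gap gives an inequality between combinations of d (q om) and
   d (h mu) which, as N > i0, forces h mu < q om: the order of F stays positive. *)
have gapd := disc_gap dsc.
have big : (N * (d * (h * mu)) + i0 * (d * (q * om)) + q * (Del * D) <=
    N * (d * (q * om)) + i0 * (d * (h * mu)))%N.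
  have h1 : (N * (h * (d * mu - i)) <= N * (q * gam))%N by rewrite leq_mul2l gap orbT.
  have h2 : (h * (N * i) <= h * (i0 * d * mu))%N by rewrite leq_mul2l ratio orbT.
  have h3 : (q * (N * gam + i0 * (d * om) + Del * D) <= q * (N * (d * om)))%N.
    by rewrite leq_mul2l gapd orbT.
  have h4 : (h * (d * mu - i) + h * i = h * (d * mu))%N by rewrite -mulnDr subnK.
  move: h1 h2 h3 h4; clear.
  rewrite (_ : d * (h * mu) = h * (d * mu))%N; last by ring.
  move: (h * (d * mu - i))%N => X h1 h2 h3 h4; rewrite -h4 !mulnDr.
  move: h1 h2 h3; rewrite !mulnDr => h1 h2 h3.
  have e1 : (h * (i0 * d * mu) = i0 * X + i0 * (h * i))%N by rewrite -mulnDr h4; ring.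
  have e2 : (h * (N * i) = N * (h * i))%N by ring.
  have e3 : (q * (N * (d * om)) = N * (d * (q * om)))%N by ring.
  have e4 : (q * (i0 * (d * om)) = i0 * (d * (q * om)))%N by ring.
  have e5 : (q * (N * gam) = N * (q * gam))%N by ring.
  lia.
have lt_om : (h * mu < q * om)%N.
  rewrite ltnNge; apply/negP => le.
  have le2 : (d * (q * om) <= d * (h * mu))%N by rewrite leq_mul2l le orbT.
  have pos : (0 < q * (Del * D))%N by rewrite !muln_gt0 q0 Del0 (disc_D dsc).
  have := iN; rewrite -subn_gt0 => e0'.
  have eN : N = (i0 + (N - i0))%N by rewrite subnKC // ltnW.
  have : ((N - i0) * (d * (q * om)) <= (N - i0) * (d * (h * mu)))%N by rewrite leq_mul2l le2 orbT.
  move: big pos; rewrite [in X in X -> _]eN !mulnDl; clear; lia.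
have emg : (a * mg = b * (d * mu))%N := disc_mup_g r.
have le_eg : (h * mg <= q * eg)%N.
  rewrite -(leq_pmul2l a0) mulnCA emg [(a * (q * eg))%N]mulnCA (disc_eg dsc).
  by rewrite !(mulnCA _ b) leq_mul2l (mulnCA h d) (mulnCA q d) leq_mul2l ltnW ?orbT.
set om1 := (q * om - h * mu)%N; set gam1 := (q * gam - h * (d * mu - i))%N.
set eg' := (q * eg - h * mg)%N.
have dom1 : (d * om1 + d * (h * mu) = d * (q * om))%N by rewrite -mulnDr subnK // ltnW.
have gam1E : (gam1 + h * (d * mu - i) = q * gam)%N by rewrite subnK.
have eg1E : (eg' + h * mg = q * eg)%N by rewrite subnK.
have eg'E : (a * eg' = b * (d * om1))%N.
  apply/eqP; rewrite -(eqn_add2r (a * (h * mg))) -mulnDr eg1E.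
  rewrite mulnCA (disc_eg dsc) [(a * (h * mg))%N]mulnCA emg.
  by apply/eqP; rewrite (mulnCA h b) -mulnDr (mulnCA h d) dom1; ring.
have gap1 : (N * gam1 + i0 * (d * om1) + Del * (q * D) <= N * (d * om1))%N.
  have h2 : (N * (h * i) <= i0 * (d * (h * mu)))%N.
    have := leq_mul (leqnn h) ratio.
    rewrite (_ : h * (i0 * d * mu) = i0 * (d * (h * mu)))%N; last by ring.
    by rewrite (_ : h * (N * i) = N * (h * i))%N //; ring.
  have h3 : (q * (N * gam + i0 * (d * om) + Del * D) <= q * (N * (d * om)))%N.
    by rewrite leq_mul2l gapd orbT.
  have h4 : (h * (d * mu - i) + h * i = d * (h * mu))%N by rewrite -mulnDr subnK //; ring.
  move: h3 (congr1 (muln N) gam1E) (congr1 (muln N) dom1) (congr1 (muln i0) dom1)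
    (congr1 (muln N) h4) h2; rewrite !mulnDr.
  rewrite (_ : q * (N * (d * om)) = N * (d * (q * om)))%N; last by ring.
  rewrite (_ : q * (i0 * (d * om)) = i0 * (d * (q * om)))%N; last by ring.
  rewrite (_ : q * (N * gam) = N * (q * gam))%N; last by ring.
  rewrite (_ : q * (Del * D) = Del * (q * D))%N; last by ring.
  clear; lia.
have rad1 : (e0 * (q * D) <= d * om1 + N * (q * Th + h))%N.
  have h1 : (q * (e0 * D) <= q * (d * om + N * Th))%N by rewrite leq_mul2l (disc_rad dsc) orbT.
  have h2 : (h * (d * mu) <= h * N)%N.
    rewrite leq_mul2l (leq_trans _ (disc_le dsc)) ?orbT // leq_mul2l le_mu orbT //.
  move: h1 h2 dom1; rewrite !mulnDr.
  rewrite (_ : q * (e0 * D) = e0 * (q * D))%N; last by ring.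
  rewrite (_ : q * (d * om) = d * (q * om))%N; last by ring.
  rewrite (_ : q * (N * Th) = N * (q * Th))%N; last by ring.
  rewrite (_ : h * N = N * h)%N; last by ring.
  rewrite (_ : h * (d * mu) = d * (h * mu))%N; last by ring.
  clear; lia.
have qD : (0 < q * D)%N by rewrite muln_gt0 q0 (disc_D dsc).
have leD : (q * D < d * om1 + eg' + (q * Th + h))%N.
  have gap1' : (i0 * (d * om1) + Del * (q * D) <= N * (d * om1))%N.
    by rewrite (leq_trans _ gap1) // -addnA leq_addl.
  have := jac_vanishes qD gap1' rad1.
  by rewrite mulnDl -eg'E -!mulnDr ltn_pmul2l.
set s1 := (d * om1 + eg' + (q * Th + h) - q * D)%N.
have s1E : (s1 + q * D = d * om1 + eg' + (q * Th + h))%N by rewrite subnK // ltnW.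
have sE : (q * s + h = s1 + (d * (h * mu) + h * mg))%N.
  have := congr1 (muln q) (disc_s dsc); rewrite !mulnDr.
  rewrite (_ : q * (d * om) = d * (q * om))%N; last by ring.
  by move: s1E dom1 eg1E; clear; lia.
exists w1, p1, g1, s1; split; last first.
  split; [exact: sw|exact: sp|exact: sg|split; [exact: cw|exact: cp|exact: cg]].
have nz (f1 : bpoly) n : size (lead0 f1) = n.+1 -> lead0 f1 != 0.
  by move=> e; rewrite -size_poly_gt0 e.
split=> //.
- exact: nz sw.
- exact: nz sp.
- exact: nz sg.
- by rewrite sw.
- by rewrite sw sp.
- by rewrite sw (leq_trans _ (disc_le dsc)) // leq_mul2l le_mu orbT.
have zF1 : zoom q h r (disc_F w p om gam) = tpow C (d * (h * mu)) * disc_F w1 p1 om1 gam1.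
  rewrite /disc_F rmorphD /= mulrDr; congr (_ + _).
    rewrite /homog rmorph_sum /= mulr_sumr; apply: eq_bigr => k _.
    rewrite !rmorphM rmorphXn /= zoom_const zoom_tpow ew exprMn tpowX.
    rewrite -!mulrA [RHS]mulrCA; congr (_ * _); rewrite !mulrA -!tpowD; congr (tpow _ _ * _).
    have kd : (k <= d)%N by rewrite -ltnS.
    have -> : (d * (h * mu) = (d - k) * (h * mu) + k * (h * mu))%N.
      by rewrite -mulnDl subnK.
    rewrite [RHS]addnAC -mulnDr [(h * mu + _)%N]addnC subnK 1?ltnW //.
    by rewrite mulnCA [(k * _)%N]mulnC.
  rewrite rmorphM /= zoom_tpow ep !mulrA -!tpowD; congr (tpow _ _ * _).
  by rewrite -gam1E -addnA -mulnDr subnK // addnC mulnCA.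
apply: (mulfI (tpow_neq0 C (d * (h * mu) + h * mg))).
rewrite -wjac_tpow -zF1 -eg1 dom1 eg1E (_ : d * (q * om) = q * (d * om))%N; last by ring.
rewrite wjac_zoom // (disc_jac dsc) rmorphM /= zoom_const zoom_tpow.
rewrite mulrCA -tpowD [(h + _)%N]addnC sE addnC tpowD !polyCMn.
by rewrite mulrnAl mulrnAr mulrCA.
Qed.

End OneDisc.

(** Along the branch chosen by [root_of_small_ratio] the order of [P] relative
    to that of [F] increases, so there must be a catch-up.  The recursion is on the
    multiplicities, then on the order of [W].  If all slopes are at least [1],
    zooming by the integral radius [1] lowers the order.  Otherwise the zoom
    goes to the first event, of radius [o / l < 1]: since [l] does not divide
    [o], the leading coefficient of [W] cannot become the power of a linear
    factor with nonzero root, so the multiplicities drop; a splitting of [G]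
    alone is excluded by [disc_mup_g]. *)
Lemma no_disc n M w p g om gam eg s D Th c :
  disc w p g om gam eg s D Th c ->
  (forall r, root (lead0 w) r -> mup r (lead0 w) + mup r (lead0 p) <= n)%N ->
  (om <= M)%N -> False.
Proof.
elim/ltn_ind: n M w p g om gam eg s D Th c => n IHn.
elim=> [|M IHM] w p g om gam eg s D Th c dsc bound leM.
  by have := disc_om_gt0 dsc; rewrite ltnNge leM.
have gam0 := disc_no_catch_up dsc.
have [r wr ratio] := 
  root_of_small_ratio (disc_w0 dsc) (disc_p0 dsc) (disc_deg dsc) (disc_ratio dsc).
have [sw [sw1 sw2]] := slopes (disc_w0 dsc) (erefl (mup r (lead0 w))).
have [sp [sp1 sp2]] := slopes (disc_p0 dsc) (erefl (mup r (lead0 p))).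
have [sg [sg1 sg2]] := slopes (disc_g0 dsc) (erefl (mup r (lead0 g))).
have zoom := disc_zoom dsc _ _ wr ratio.
have emg := disc_mup_g dsc r.
set mu := mup r (lead0 w) in ratio sw1 sw2 zoom emg *.
set i := mup r (lead0 p) in ratio sp1 sp2 zoom *.
set mg := mup r (lead0 g) in sg1 sg2 zoom emg *.
have mu0 : (0 < mu)%N by rewrite -XsubC_dvd ?(disc_w0 dsc) // dvdp_XsubCl.
have lt_i : (i < d * mu)%N.
  rewrite -(ltn_pmul2l (leq_ltn_trans (leq0n i0) i0_lt_N)) (leq_ltn_trans ratio) //.
  by rewrite -mulnA ltn_pmul2r ?i0_lt_N // muln_gt0 d_gt0.
have bound_r : (mu + i <= n)%N := bound r wr.
set x0 := (gam, d * mu - i)%N.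
have [[o l] xs xmin] : exists2 x, x \in x0 :: sw ++ sp ++ sg &
    forall y, y \in x0 :: sw ++ sp ++ sg -> (x.1 * y.2 <= y.1 * x.2)%N.
  apply: min_slope => -[o l]; rewrite inE !mem_cat.
  case/or4P=> [/eqP[_ ->]|/sw2[]|/sp2[]|/sg2[]] //.
  by rewrite subn_gt0.
have [o0 l0] : (0 < o /\ 0 < l)%N.
  move: xs; rewrite inE !mem_cat.
  case/or4P=> [/eqP[-> ->]|/sw2[]|/sp2[]|/sg2[]] //.
  by rewrite subn_gt0 lt0n.
have inw y : y \in sw -> (o * y.2 <= y.1 * l)%N.
  by move=> ys; apply: (xmin y); rewrite inE !mem_cat ys orbT.
have inp y : y \in sp -> (o * y.2 <= y.1 * l)%N.
  by move=> ys; apply: (xmin y); rewrite inE !mem_cat ys !orbT.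
have ing y : y \in sg -> (o * y.2 <= y.1 * l)%N.
  by move=> ys; apply: (xmin y); rewrite inE !mem_cat ys !orbT.
have in0 : (o * (d * mu - i) <= gam * l)%N by apply: (xmin x0); rewrite inE eqxx.
have [le_lo|lt_ol] := leqP l o.
  have unit_ok y1 y2 : (o * y2 <= y1 * l -> 1 * y2 <= 1 * y1)%N.
    rewrite !mul1n => le; rewrite -(leq_pmul2r l0) (leq_trans _ le) //.
    by rewrite mulnC leq_mul2r le_lo orbT.
  have [||||w1 [p1 [g1 [s1 [dsc1 [[zw zp zg] _]]]]]] := zoom 1%N 1%N isT isT.
  - by move=> k j km akj; apply/unit_ok/(inw (_, _))/sw1.
  - by move=> k j km akj; apply/unit_ok/(inp (_, _))/sp1.
  - by move=> k j km akj; apply/unit_ok/(ing (_, _))/sg1.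
  - exact: unit_ok.
  apply: (IHM _ _ _ _ _ _ _ _ _ _ dsc1).
    move=> r' _; apply: leq_trans bound_r; apply: leq_add.
      by rewrite -ltnS -zw mup_lt_size // (disc_w0 dsc1).
    by rewrite -ltnS -zp mup_lt_size // (disc_p0 dsc1).
  rewrite !mul1n leq_subLR (leq_trans leM) // -add1n leq_add2r //.
have [||||w1 [p1 [g1 [s1 [dsc1 [[zw zp zg] [cw cp cg]]]]]]] := zoom l o l0 o0.
- by move=> k j km akj; rewrite [(l * _)%N]mulnC; apply/(inw (_, _))/sw1.
- by move=> k j km akj; rewrite [(l * _)%N]mulnC; apply/(inp (_, _))/sp1.
- by move=> k j km akj; rewrite [(l * _)%N]mulnC; apply/(ing (_, _))/sg1.
- by rewrite [(l * _)%N]mulnC.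
suff drop r' : root (lead0 w1) r' -> (mup r' (lead0 w1) + mup r' (lead0 p1) < mu + i)%N.
  have n0 : (0 < n)%N by rewrite (leq_trans _ bound_r) // addn_gt0 mu0.
  apply: (IHn n.-1 _ _ _ _ _ _ _ _ _ _ _ _ dsc1 _ (leqnn _)); first by rewrite prednK.
  by move=> r' /drop lt; rewrite -ltnS prednK // (leq_trans lt).
move=> w1r'.
have lw : (mup r' (lead0 w1) <= mu)%N by rewrite -ltnS -zw mup_lt_size // (disc_w0 dsc1).
have lp : (mup r' (lead0 p1) <= i)%N by rewrite -ltnS -zp mup_lt_size // (disc_p0 dsc1).
rewrite ltn_neqAle leq_add // andbT; apply/eqP => esum.
have ew : mup r' (lead0 w1) = mu.
  by apply/eqP; rewrite eqn_leq lw -(leq_add2r i) -esum leq_add2l.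
have ep : mup r' (lead0 p1) = i by apply/eqP; rewrite -(eqn_add2l mu) -{1}ew esum.
(* No multiplicity drops only if lead0 w1 and lead0 p1 are powers of the same linear
   factor; its root is zero because the subleading coefficient of lead0 w1 lies on
   the side of slope o / l only if l divides o. *)
have r'0 : r' = 0.
  have fw : lead0 w1 = lead_coef (lead0 w1) *: ('X - r'%:P) ^+ mu.
    by rewrite -ew; apply: mup_full; rewrite ?(disc_w0 dsc1) // ew zw.
  have : (lead0 w1)`_mu.-1 = 0.
    rewrite cw (_ : mu - mu.-1 = 1)%N; last by case: (mu) mu0 => // m _; rewrite /= subSnn.
    by rewrite muln1 gtnNdvd // andbF.
  rewrite fw coefZ -[in X in _ ^+ X](prednK mu0) coef_XsubC_exp => /eqP.
  rewrite mulf_eq0 lead_coef_eq0 (negPf (disc_w0 dsc1)) mulrn_eq0 oppr_eq0 /=.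
  by move/eqP.
rewrite r'0 in ew ep.
have flat_w k : (k < mu)%N -> (lead0 w1)`_k = 0.
  by move=> km; apply: coef_full_mup0; rewrite ?(disc_w0 dsc1) ?zw.
have flat_p k : (k < i)%N -> (lead0 p1)`_k = 0.
  by move=> km; apply: coef_full_mup0; rewrite ?(disc_p0 dsc1) ?zp.
have flat_g k : (k < mg)%N -> (lead0 g1)`_k = 0.
  move=> km; apply: coef_full_mup0; rewrite ?(disc_g0 dsc1) ?zg //=.
  apply/eqP; rewrite -(eqn_pmul2l a0) (disc_mup_g dsc1) ew; exact/eqP/esym.
have hit k m : (k < m)%N -> l = (m - k)%N ->
    ((k <= m) && (l %| o * (m - k)))%N /\ (o * (m - k) %/ l = o)%N.
  by move=> km el; rewrite ltnW // -el dvdn_mull // mulnK.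
(* The point realizing the minimal slope gives a lower nonzero coefficient. *)
move: xs; rewrite inE !mem_cat => /or4P[/eqP[eo el]|/sw2[_ _]|/sp2[_ _]|/sg2[_ _]].
- by have := disc_no_catch_up dsc1; rewrite -el eo mulnC subnn.
- case=> k km [el /negP]; apply; have := flat_w k km; rewrite cw.
  by case: (hit k mu km el) => -> -> ->.
- case=> k km [el /negP]; apply; have := flat_p k km; rewrite cp.
  by case: (hit k i km el) => -> -> ->.
- case=> k km [el /negP]; apply; have := flat_g k km; rewrite cg.
  by case: (hit k mg km el) => -> -> ->.
Qed.

End Discs.

(** * The first disc *)

Section Reversal.
Variable C : numClosedFieldType.
Local Notation bpoly := {poly {poly C}}.
Implicit Types (f g : bpoly) (p q : {poly C}).

(** [t^n p(1/t)], which is meaningful for [p] of degree at most [n]. *)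
Definition recip n p : {poly C} := \poly_(j < n.+1) p`_(n - j).

Lemma coef_recip n p j : (recip n p)`_j = if (j <= n)%N then p`_(n - j) else 0.
Proof. by rewrite coef_poly ltnS. Qed.

Lemma recip0 n : recip n 0 = 0.
Proof. by apply/polyP => j; rewrite coef_recip !coef0 if_same. Qed.

Lemma recipD n p q : recip n (p + q) = recip n p + recip n q.
Proof. by apply/polyP => j; rewrite coefD !coef_recip coefD; case: ifP; rewrite ?addr0. Qed.

Lemma recipN n p : recip n (- p) = - recip n p.
Proof. by apply/polyP => j; rewrite coefN !coef_recip coefN; case: ifP; rewrite ?oppr0. Qed.

Lemma recipZ n c p : recip n (c *: p) = c *: recip n p.
Proof. by apply/polyP => j; rewrite coefZ !coef_recip coefZ; case: ifP; rewrite ?mulr0. Qed.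

Lemma recip_sum n I (r : seq I) (F : I -> {poly C}) :
  recip n (\sum_(i <- r) F i) = \sum_(i <- r) recip n (F i).
Proof. by elim/big_ind2: _ => [|p1 q1 p2 q2 <- <-|//]; rewrite ?recip0 ?recipD. Qed.

Lemma recipXn n k : (k <= n)%N -> recip n 'X^k = 'X^(n - k).
Proof.
move=> kn; apply/polyP => j; rewrite coef_recip !coefXn; case: leqP => jn.
  by congr ((nat_of_bool _)%:R); apply/eqP/eqP => e; rewrite ?e ?subKn // -e subKn.
by case: eqP => // e; move: jn; rewrite e ltnNge leq_subr.
Qed.

Lemma recipM n m p q : (size p <= n.+1)%N -> (size q <= m.+1)%N ->
  recip (n + m) (p * q) = recip n p * recip m q.
Proof.
have expand k (u : {poly C}) : (size u <= k.+1)%N -> u = \sum_(i < k.+1) u`_i *: 'X^i.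
  move=> su; rewrite -poly_def; apply/polyP => i; rewrite coef_poly; case: ltnP => // le.
  by rewrite nth_default // (leq_trans su).
move=> /expand ep /expand eq; rewrite ep eq big_distrlr /= !recip_sum big_distrlr /=.
apply: eq_bigr => i _; rewrite recip_sum; apply: eq_bigr => j _.
have li : (i <= n)%N by rewrite -ltnS.
have lj : (j <= m)%N by rewrite -ltnS.
rewrite -scalerAl -scalerAr -exprD !recipZ !recipXn ?leq_add // -scalerAl -scalerAr -exprD.
by congr (_ *: (_ *: 'X^_)); rewrite subnDA -addnBAC // addnBA.
Qed.

Definition ydeg_le n f := forall i : nat, (size (f`_i)%R <= n.+1)%N.

Definition yrev n f : bpoly := map_poly (recip n) f.

Lemma coef_yrev n f i : (yrev n f)`_i = recip n f`_i.
Proof. by rewrite coef_map_id0 // recip0. Qed.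

Lemma yrevD n f g : yrev n (f + g) = yrev n f + yrev n g.
Proof. by apply/polyP => i; rewrite coefD !coef_yrev coefD recipD. Qed.

Lemma yrevN n f : yrev n (- f) = - yrev n f.
Proof. by apply/polyP => i; rewrite coefN !coef_yrev coefN recipN. Qed.

Lemma yrev_sum n I (r : seq I) (F : I -> bpoly) :
  yrev n (\sum_(i <- r) F i) = \sum_(i <- r) yrev n (F i).
Proof.
elim/big_ind2: _ => [|p1 q1 p2 q2 <- <-|//]; rewrite ?yrevD //.
by rewrite /yrev map_poly0.
Qed.

Lemma yrevM n m f g : ydeg_le n f -> ydeg_le m g ->
  yrev (n + m) (f * g) = yrev n f * yrev m g.
Proof.
move=> fn gm; apply/polyP => k; rewrite coef_yrev !coefM recip_sum.
by apply: eq_bigr => i _; rewrite recipM // !coef_yrev.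
Qed.

Lemma ydeg_leM n m f g : ydeg_le n f -> ydeg_le m g -> ydeg_le (n + m) (f * g).
Proof.
move=> fn gm k; rewrite coefM (leq_trans (size_sum _ _ _)) //.
apply/bigmax_leqP => i _; rewrite (leq_trans (size_mul_leq _ _)) //.
have := leq_add (fn i) (gm (k - i)%N); rewrite addSn addnS.
by case: (size _ + size _)%N.
Qed.

Lemma ydeg_le_const (c : C) : ydeg_le 0 c%:P%:P.
Proof. by move=> i; rewrite coefC; case: eqP; rewrite ?size_poly0 // size_polyC; case: eqP. Qed.

Lemma yrev_const m (c : C) : yrev m c%:P%:P = c%:P%:P * tpow C m.
Proof.
apply/polyP => i; rewrite coef_yrev /tpow -polyCM !coefC; case: eqP => _; last exact: recip0.
have r1 : recip m 1 = 'X^m by rewrite -(expr0 'X) recipXn // subn0.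
by rewrite -[c%:P in LHS]mulr1 !mul_polyC recipZ r1.
Qed.

Lemma ydeg_leX n f k : ydeg_le n f -> ydeg_le (k * n) (f ^+ k).
Proof.
move=> fn; elim: k => [|k IH]; last by rewrite exprS mulSn; apply: ydeg_leM.
by rewrite expr0 -[1]/(1%:P%:P); apply: ydeg_le_const.
Qed.

Lemma yrevX n f k : ydeg_le n f -> yrev (k * n) (f ^+ k) = yrev n f ^+ k.
Proof.
move=> fn; elim: k => [|k IH]; last by rewrite !exprS mulSn yrevM ?IH //; apply: ydeg_leX.
by rewrite !expr0 mul0n -[1]/(1%:P%:P) yrev_const tpow0 mulr1.
Qed.

Lemma yrev_up n m f : ydeg_le n f -> (n <= m)%N -> yrev m f = tpow C (m - n) * yrev n f.
Proof.
move=> fn nm; rewrite -{1}(subnK nm) -[f in LHS]mul1r.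
have d1 : ydeg_le (m - n) 1.
  move=> i; rewrite (leq_trans (ydeg_le_const 1 i)) //.
rewrite yrevM // -[1]/(1%:P%:P) yrev_const mul1r //.
Qed.

Lemma yrev_deriv n f : (yrev n f)^`() = yrev n f^`().
Proof.
apply/polyP => i; rewrite coef_deriv !coef_yrev coef_deriv.
by rewrite -!scaler_nat recipZ.
Qed.

Lemma teuler_yrev n f : teuler (yrev n f) = yrev n f *+ n - yrev n (teuler f).
Proof.
apply/polyP => i; rewrite coefB coefMn !(coef_teuler, coef_yrev).
have te (p : {poly C}) j : ('X * p^`())`_j = p`_j *+ j.
  by rewrite coefXM coef_deriv; case: j.
apply/polyP => j; rewrite te coefB coefMn !coef_recip te.
case: leqP => jn; last by rewrite !mul0rn subr0.
by rewrite -mulrnBr ?leq_subr // subKn.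
Qed.

Lemma lead0_yrev n f i : (lead0 (yrev n f))`_i = f`_i`_n.
Proof. by rewrite coef_lead0 coef_yrev coef_recip subn0. Qed.

Lemma teuler_dy f : teuler f = tpow C 1 * map_poly (@deriv C) f.
Proof.
by apply/polyP => i; rewrite coef_teuler coefCM coef_map_id0 ?deriv0 // expr1.
Qed.

Lemma wjac_yrev n m f g (c : C) : ydeg_le n f -> ydeg_le m g -> (0 < n + m)%N ->
  f^`() * map_poly (@deriv C) g - map_poly (@deriv C) f * g^`() = c%:P%:P ->
  wjac n m (yrev n f) (yrev m g) = (- c)%:P%:P * tpow C (n + m).-1.
Proof.
move=> fn gm nm0 J; rewrite /wjac !teuler_yrev !yrev_deriv.
have dd k h : ydeg_le k h -> ydeg_le k h^`().
  by move=> hk i; rewrite coef_deriv -scaler_nat (leq_trans (size_scale_leq _ _)).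
have de k h : ydeg_le k h -> ydeg_le k (teuler h).
  move=> hk i; rewrite coef_teuler; apply/leq_sizeP => j kj.
  rewrite coefXM coef_deriv; case: j kj => // j kj.
  by rewrite nth_default ?mul0rn // (leq_trans (hk i)).
transitivity (- yrev (n + m) (f^`() * teuler g - teuler f * g^`())).
  rewrite yrevD yrevN !yrevM; [|exact: de|exact: dd|exact: dd|exact: de].
  move: (yrev n f) (yrev m g) (yrev n f^`()) (yrev m g^`())
    (yrev n (teuler f)) (yrev m (teuler g)) => A B A' B' A1 B1.
  ring.
rewrite !teuler_dy (_ : _ - _ = tpow C 1 * c%:P%:P); last by rewrite -J; ring.
rewrite -yrevN -mulrN -!polyCN -(prednK nm0) -add1n yrevM; last 2 first.
- move=> i; rewrite /tpow expr1 coefC; case: eqP; rewrite ?size_polyX ?size_poly0 //.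
- by move=> i; rewrite (leq_trans (ydeg_le_const _ i)).
rewrite yrev_const -[RHS]mul1r; congr (_ * _).
apply/polyP => i; rewrite coef_yrev /tpow expr1 coefC coef1; case: eqP => _; last exact: recip0.
by rewrite -['X]expr1 recipXn // subnn expr0.
Qed.

End Reversal.

(** * Remainders with a steep top row *)

Section Start.
Variable C : numClosedFieldType.
Local Notation bpoly := {poly {poly C}}.

(** The first disc is the whole line: [y = 1/t] and [xi = x], so that the leading
    coefficients are the top rows of the polynomials.  The top row of [P] is steep
    when its end [(i0, eP)] is above the diagonal through [(N, e0)]. *)
Lemma no_steep_remainder (a b delta nu om eg i0 eP : nat) (beta : {poly C})
    (F G W P : bpoly) (c : C) :
  (0 < a)%N -> (0 < b)%N -> coprime a b -> (0 < delta)%N -> (0 < nu)%N -> (0 < om)%N ->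
  beta`_(a * delta) = 1 ->
  let N := (a * delta * nu)%N in let e0 := (a * delta * om)%N in
  F = \sum_(k < (a * delta).+1) (beta`_k)%:P%:P * W ^+ k + P ->
  ydeg_le om W -> W`_nu`_om != 0 -> (forall i, (nu < i)%N -> W`_i`_om = 0) ->
  ydeg_le eP P -> (eP <= e0)%N -> P`_i0`_eP != 0 -> (forall i, (i0 < i)%N -> P`_i`_eP = 0) ->
  ydeg_le e0 F -> ydeg_le eg G -> (a * eg = b * e0)%N -> (exists i, G`_i`_eg != 0) ->
  F^`() * map_poly (@deriv C) G - map_poly (@deriv C) F * G^`() = c%:P%:P ->
  (a * i0 < a.-1 * N)%N -> (i0 * e0 < N * eP)%N ->
  (forall A D Th, 0 < D -> i0 * A + (N * eP - i0 * e0) * D <= N * A ->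
     e0 * D <= A + N * Th -> a * D < (a + b) * A + a * Th)%N ->
  False.
Proof.
move=> a0 b0 cab delta0 nu0 om0 btop N e0 eF dW Wtop Wright dP lP Ptop Pright.
move=> dF dG egE [ig Gtop] J i0N steep jac_vanishes.
set d := (a * delta)%N in btop N e0 eF lP dF egE i0N steep jac_vanishes.
have d0 : (0 < d)%N by rewrite muln_gt0 a0.
have e00 : (0 < e0)%N by rewrite muln_gt0 d0.
have szr n (f : bpoly) k : f`_k`_n != 0 -> (forall i, (k < i)%N -> f`_i`_n = 0) ->
    size (lead0 (yrev n f)) = k.+1 :> nat.
  move=> fk fr; apply/eqP; rewrite eqn_leq; apply/andP; split.
    by apply/leq_sizeP => j kj; rewrite lead0_yrev fr.
  by rewrite ltnNge; apply/negP => /leq_sizeP/(_ _ (leqnn _))/eqP; rewrite lead0_yrev (negPf fk).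
have sW := szr _ _ _ Wtop Wright; have sP := szr _ _ _ Ptop Pright.
have fE : yrev e0 F = disc_F a delta beta (yrev om W) (yrev eP P) om (e0 - eP).
  rewrite eF yrevD (yrev_up dP lP) yrev_sum; congr (_ + _).
  apply: eq_bigr => k _; have kd : (k <= d)%N by rewrite -ltnS.
  have -> : e0 = (0 + (d - k) * om + k * om)%N by rewrite add0n -mulnDl subnK.
  rewrite yrevM; [|by move=> i; rewrite (leq_trans (ydeg_le_const _ i))|exact: ydeg_leX].
  by rewrite yrevX // yrev_const add0n.
have nz (f1 : {poly C}) k : size f1 = k.+1 -> f1 != 0 by move=> e; rewrite -size_poly_gt0 e.
apply: (@no_disc C a b delta N i0 e0 (N * eP - i0 * e0) beta a0 b0 cab delta0 btop
   i0N _ jac_vanishes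
   (nu + i0) om (yrev om W) (yrev eP P) (yrev eg G) om (e0 - eP) eg (e0 + eg).-1 1 0 (- c));
  last exact: leqnn.
- by rewrite subn_gt0.
- split=> //.
  + exact: nz sW.
  + exact: nz sP.
  + by apply: contraNneq Gtop => r0; rewrite -lead0_yrev r0 coef0.
  + by rewrite sW.
  + by rewrite sW sP /= mulnC /N mulnA.
  + by rewrite sW.
  + rewrite muln1 -addnA subnKC ?(ltnW steep) // -mulnDr subnK //.
  + by rewrite muln0 addn0 muln1.
  + by rewrite addn1 prednK ?addn0 // addn_gt0 e00.
  + by rewrite -fE; apply: wjac_yrev; rewrite // addn_gt0 e00.
- move=> r _; apply: leq_add.
    by rewrite -ltnS -sW mup_lt_size // (nz _ _ sW).
  by rewrite -ltnS -sP mup_lt_size // (nz _ _ sP).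
Qed.

End Start.

(** * The corner of the remainder *)

(** Here [m D <= n D], so [m (D - Th)] is at most [A]. *)
Lemma jac_vanishes_y_base (a b m n i j A D Th : nat) : (0 < b -> 0 < m -> m <= n ->
  i * n < m * j -> 0 < D ->
  i * A + (m * j - i * n) * D <= m * A -> n * D <= A + m * Th ->
  a * D < (a + b) * A + a * Th)%N.
Proof.
move=> b0 m0 mn steep D0 gap rad.
have A0 : (0 < A)%N.
  rewrite lt0n; apply: contraL gap => /eqP ->.
  by rewrite !muln0 add0n -ltnNge muln_gt0 subn_gt0 steep.
have [le|lt] := leqP D Th.
  apply: (@leq_ltn_trans (a * Th)); first by rewrite leq_mul2l le orbT.
  by rewrite -[ltnLHS]add0n ltn_add2r muln_gt0 addn_gt0 b0 orbT.
have le : (D - Th <= A)%N.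
  rewrite -(leq_pmul2l m0) mulnBr leq_subLR.
  apply: (@leq_trans (n * D)); first by rewrite leq_mul2r mn orbT.
  by rewrite (leq_trans rad) // addnC leq_add2l leq_pmull.
rewrite -[in X in (X < _)%N](subnK (ltnW lt)) mulnDr ltn_add2r mulnDl.
apply: (@leq_ltn_trans (a * A)); first by rewrite leq_mul2l le orbT.
by rewrite -[ltnLHS]addn0 ltn_add2l muln_gt0 b0.
Qed.

(** For a point [(i, j)] below the diagonal, [n i - j m] is a positive multiple of
    [a]; this keeps the order [A / D] of [F] at least [a / (n - j)], and at least
    [1] when [j = 0].  Combined with [n - m < a + b] this is just enough. *)
Lemma jac_vanishes_x_base (a b m n i j A D Th : nat) : (0 < a -> 0 < b -> 0 < n -> m <= n ->
  n < m + a + b -> a %| n * i - j * m ->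
  j * m < n * i -> 0 < D ->
  j * A + (n * i - j * m) * D <= n * A -> m * D <= A + n * Th ->
  a * D < (a + b) * A + a * Th)%N.
Proof.
move=> a0 b0 n0 mn narrow aDel steep D0 gap rad.
have A0 : (0 < A)%N.
  rewrite lt0n; apply: contraL gap => /eqP ->.
  by rewrite !muln0 add0n -ltnNge muln_gt0 subn_gt0 steep.
have fine : (D <= A -> a * D < (a + b) * A + a * Th)%N.
  move=> le; apply: (@leq_ltn_trans (a * A)); first by rewrite leq_mul2l le orbT.
  by rewrite mulnDl -addnA -[ltnLHS]addn0 ltn_add2l addn_gt0 muln_gt0 b0 A0.
case: j steep aDel gap => [|j] steep aDel gap.
  apply: fine; move: gap steep; rewrite !mul0n subn0 add0n -mulnA leq_pmul2l // muln_gt0.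
  by move=> le /andP[_ i0]; rewrite (leq_trans _ le) // leq_pmull.
have Del_a : (a <= n * i - j.+1 * m)%N by rewrite dvdn_leq // subn_gt0.
have le1 : (a * D + A <= n * A)%N.
  rewrite (leq_trans _ gap) // addnC leq_add ?leq_pmull // leq_mul2r Del_a orbT //.
rewrite ltnNge; apply/negP => contra.
pose B := (n - m)%N; have nE : n = (m + B)%N by rewrite subnKC.
have B1 : (B < a + b)%N by move: narrow; rewrite nE -addnA ltn_add2l.
have h1 : (n * ((a + b) * A) + n * (a * Th) <= n * (a * D))%N.
  by rewrite -mulnDr leq_mul2l contra orbT.
have h2 : (n * (a * D) <= a * A + n * (a * Th) + B * (a * D))%N.
  rewrite (_ : n * (a * D) = a * (m * D) + B * (a * D))%N; last by rewrite {1}nE; ring.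
  rewrite leq_add2r (_ : n * (a * Th) = a * (n * Th))%N; last by ring.
  by rewrite -mulnDr leq_mul2l rad orbT.
have h3 : (B * (a * D) + B * A <= B * (n * A))%N by rewrite -mulnDr leq_mul2l le1 orbT.
have h4 : (B * (n * A) + n * A + (a + b) * A <= (a + b) * (n * A) + A + B * A)%N.
  have [k kE] : exists k, (a + b = B + k.+1)%N.
    by exists (a + b - B).-1; rewrite prednK ?subn_gt0 // subnKC // ltnW.
  have hk : (k * A <= k * (n * A))%N by rewrite leq_mul2l leq_pmull ?orbT.
  have e1 : ((a + b) * (n * A) = B * (n * A) + k * (n * A) + n * A)%N by rewrite kE; ring.
  have e2 : ((a + b) * A = B * A + k * A + A)%N by rewrite kE; ring.
  by rewrite e1 e2; move: hk; clear; lia.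
have h5 : ((a + b) * A = a * A + b * A)%N by rewrite mulnDl.
have h6 : (A <= b * A)%N by rewrite leq_pmull.
have h7 : (A <= n * A)%N by rewrite leq_pmull.
have h8 : (n * ((a + b) * A) = (a + b) * (n * A))%N by ring.
move: h1 h2 h3 h4 h5 h6 h7 h8 A0; clear; lia.
Qed.

Section Corner.
Variable C : numClosedFieldType.
Local Notation bpoly := {poly {poly C}}.

Lemma top_row (P : bpoly) : P != 0 -> exists e i,
  [/\ ydeg_le e P, P`_i`_e != 0 & forall k, (i < k)%N -> P`_k`_e = 0].
Proof.
move=> P0; have S0 : swapXY P != 0 by rewrite swapXY_eq0.
pose e := (size (swapXY P)).-1; pose row := (swapXY P)`_e.
have row0 : row != 0 by rewrite /row /e -lead_coefE lead_coef_eq0.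
exists e, (size row).-1; split=> [i||k lk].
- apply/leq_sizeP => j lj; rewrite -coef_swapXY.
  by rewrite [(swapXY P)`_j]nth_default ?coef0 // (leq_trans _ lj) // leqSpred.
- by rewrite -coef_swapXY -lead_coefE lead_coef_eq0.
- by rewrite -coef_swapXY nth_default // (leq_trans (leqSpred _)).
Qed.

Lemma deriv_swapXY (f : bpoly) : (swapXY f)^`() = swapXY (map_poly (@deriv C) f).
Proof.
apply/polyP => i; apply/polyP => j.
by rewrite coef_deriv coefMn !coef_swapXY coef_map_id0 ?deriv0 // coef_deriv.
Qed.

Lemma map_deriv_swapXY (f : bpoly) : map_poly (@deriv C) (swapXY f) = swapXY f^`().
Proof. by rewrite -[in RHS](swapXYK f) deriv_swapXY swapXYK. Qed.

Lemma swapXY_const (c : C) : swapXY c%:P%:P = c%:P%:P :> bpoly.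
Proof. by rewrite swapXY_polyC map_polyC. Qed.

Definition in_rect (u v : nat) (f : bpoly) :=
  forall i j, f`_i`_j != 0 -> (i <= u)%N && (j <= v)%N.

Lemma in_rect_ydeg u v f : in_rect u v f -> ydeg_le v f.
Proof.
move=> r i; apply/leq_sizeP => j vj; apply/eqP; apply: contraTT vj => /r /andP[_].
by rewrite -leqNgt.
Qed.

Lemma in_rect_swap u v f : in_rect u v f -> in_rect v u (swapXY f).
Proof. by move=> r i j; rewrite coef_swapXY andbC; apply: r. Qed.

Lemma in_rect_right u v f i j : in_rect u v f -> (u < i)%N -> f`_i`_j = 0.
Proof. by move=> r ui; apply/eqP; apply: contraTT ui => /r /andP[+ _]; rewrite -leqNgt. Qed.

(** The end of the top row of [P] is not above the diagonal and the upper end of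
    its rightmost column is not below; as the first lies weakly to the upper left
    of the second, both are the same point of the diagonal. *)
Lemma remainder_corner (a b delta nu om : nat) (beta : {poly C}) (F G W P : bpoly) (c : C) :
  let m := (a * delta * nu)%N in let n := (a * delta * om)%N in
  (0 < a)%N -> (0 < b)%N -> coprime a b -> (0 < delta)%N -> (0 < nu)%N -> (0 < om)%N ->
  (m <= n)%N -> (n < m + a + b)%N -> beta`_(a * delta) = 1 ->
  F = \sum_(k < (a * delta).+1) (beta`_k)%:P%:P * W ^+ k + P ->
  in_rect nu om W -> W`_nu`_om != 0 -> in_rect m n F ->
  in_rect (b * (delta * nu)) (b * (delta * om)) G ->
  G`_(b * (delta * nu))`_(b * (delta * om)) != 0 ->
  F^`() * map_poly (@deriv C) G - map_poly (@deriv C) F * G^`() = c%:P%:P ->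
  in_rect m n P -> P != 0 ->
  (forall i j, P`_i`_j != 0 -> (a * i < a.-1 * m)%N || (a * j < a.-1 * n)%N) ->
  exists i j, [/\ P`_i`_j != 0, in_rect i j P & (m * j = n * i)%N].
Proof.
move=> m n a0 b0 cab delta0 nu0 om0 mn narrow btop eF rW Wc rF rG Gc J rP P0 low.
have d0 : (0 < a * delta)%N by rewrite muln_gt0 a0.
have m0 : (0 < m)%N by rewrite muln_gt0 d0.
have n0 : (0 < n)%N by rewrite muln_gt0 d0.
have [jt [it [dPt Pt Ptr]]] := top_row P0.
have [ir [jr [dPr Pr Prr]]] : exists e i, [/\ ydeg_le e (swapXY P),
    (swapXY P)`_i`_e != 0 & forall k, (i < k)%N -> (swapXY P)`_k`_e = 0].
  by apply: top_row; rewrite swapXY_eq0.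
rewrite coef_swapXY in Pr.
have low1 u v x y : (0 < u -> 0 < v -> x * v < u * y ->
    (a * x < a.-1 * u) || (a * y < a.-1 * v) -> a * x < a.-1 * u)%N.
  move=> u0 v0 lt /orP[//|lt2].
  rewrite -(ltn_pmul2r v0) -mulnA (@leq_trans (a * (u * y))) ?ltn_pmul2l //.
  by rewrite mulnCA (mulnAC _ u) [leqRHS]mulnC leq_mul2l ltnW ?orbT.
have top : (m * jt <= n * it)%N.
  rewrite leqNgt; apply/negP => steep; rewrite [(n * it)%N]mulnC in steep.
  have lj : (jt <= n)%N by have /andP[] := rP _ _ Pt.
  apply: (@no_steep_remainder C a b delta nu om (b * (delta * om)) it jt beta F G W P c) => //.
  - exact: in_rect_ydeg rW.
  - by move=> i; apply: in_rect_right rW.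
  - exact: in_rect_ydeg rF.
  - exact: in_rect_ydeg rG.
  - by rewrite /n; ring.
  - by exists (b * (delta * nu))%N.
  - exact: low1 (low _ _ Pt).
  - by move=> A D Th D0; apply: jac_vanishes_y_base.
have right : (n * ir <= m * jr)%N.
  rewrite leqNgt; apply/negP => steep; rewrite [(m * jr)%N]mulnC in steep.
  have li : (ir <= m)%N by have /andP[] := rP _ _ Pr.
  apply: (@no_steep_remainder C a b delta om nu (b * (delta * nu)) jr ir beta
    (swapXY F) (swapXY G) (swapXY W) (swapXY P) (- c)) => //.
  - rewrite eF rmorphD rmorph_sum /=; congr (_ + _); apply: eq_bigr => k _.
    by rewrite rmorphM rmorphXn /= swapXY_const.
  - exact/in_rect_ydeg/in_rect_swap/rW.
  - by rewrite coef_swapXY.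
  - by move=> i; apply: in_rect_right; apply: in_rect_swap rW.
  - by rewrite coef_swapXY.
  - exact/in_rect_ydeg/in_rect_swap/rF.
  - exact/in_rect_ydeg/in_rect_swap/rG.
  - by rewrite /m; ring.
  - by exists (b * (delta * om))%N; rewrite coef_swapXY.
  - rewrite !deriv_swapXY !map_deriv_swapXY -!rmorphM -rmorphB /=.
    rewrite (_ : _ - _ = - c%:P%:P); last by rewrite -J; ring.
    by rewrite -!polyCN swapXY_const.
  - by apply: (low1 n m jr ir n0 m0 steep); rewrite orbC; apply: low Pr.
  - move=> A D Th D0; apply: jac_vanishes_x_base => //.
    have am : (a %| m)%N by rewrite /m -mulnA dvdn_mulr.
    have an : (a %| n)%N by rewrite /n -mulnA dvdn_mulr.
    exact: dvdn_sub (dvdn_mulr _ an) (dvdn_mull _ am).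
have rPt i j : P`_i`_j != 0 -> (j <= jt)%N.
  move=> Pij; rewrite -ltnS (leq_trans _ (dPt i)) // ltnNge.
  by apply: contra Pij => le; rewrite nth_default.
have rPr i j : P`_i`_j != 0 -> (i <= ir)%N.
  move=> Pij; rewrite -ltnS (leq_trans _ (dPr j)) // ltnNge.
  by apply: contra Pij => le; rewrite -coef_swapXY nth_default.
have le_i : (it <= ir)%N := rPr _ _ Pt.
have le_j : (jr <= jt)%N := rPt _ _ Pr.
have ei : it = ir.
  apply/eqP; rewrite eqn_leq le_i -(leq_pmul2l n0) (leq_trans right) //.
  by rewrite (leq_trans _ top) // leq_mul2l le_j orbT.
have ej : jr = jt.
  apply/eqP; rewrite eqn_leq le_j -(leq_pmul2l m0) (leq_trans top) //.
  by rewrite ei.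
exists it, jt; split=> //; first by move=> i j Pij; rewrite ei (rPr i j) // (rPt i j).
by apply/eqP; rewrite eqn_leq top ei -ej right.
Qed.

End Corner.

Local Open Scope classical_set_scope.
Local Open Scope ring_scope.

(** * Inner and innermost polynomials *)

Section Rectangles.
Variable C : numClosedFieldType.
Local Notation bpoly := {poly {poly C}}.
Implicit Types f g W Q : bpoly.

Lemma in_rectP u v f : in_rect u v f <-> (size f <= u.+1)%N /\ ydeg_le v f.
Proof.
split=> [r|[sf yf] i j fij].
  split; last exact: in_rect_ydeg r.
  by apply/leq_sizeP => i ui; apply/polyP => j; rewrite coef0; apply: in_rect_right r _.
apply/andP; split; rewrite -ltnS.
  rewrite (leq_trans _ sf) // ltnNge; apply: contra fij => le.
  by rewrite [f`_i]nth_default // coef0.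
by rewrite (leq_trans _ (yf i)) // ltnNge; apply: contra fij => le; rewrite nth_default.
Qed.

Lemma in_rectM u v u' v' f g : in_rect u v f -> in_rect u' v' g ->
  in_rect (u + u') (v + v') (f * g).
Proof.
move=> /in_rectP[sf yf] /in_rectP[sg yg]; apply/in_rectP; split; last exact: ydeg_leM.
rewrite (leq_trans (size_mul_leq _ _)) //.
by have := leq_add sf sg; rewrite addSn addnS; case: (size _ + size _)%N.
Qed.

Lemma in_rectX u v f k : in_rect u v f -> in_rect (k * u) (k * v) (f ^+ k).
Proof.
move=> r; elim: k => [|k IH]; last by rewrite exprS !mulSn; apply: in_rectM.
apply/in_rectP; split; first by rewrite expr0 size_poly1.
by have := ydeg_leX 0 (in_rect_ydeg r); rewrite !mul0n.
Qed.

Lemma in_rect_corner u v f : in_rect u v f -> f`_u`_v != 0 -> (size f).-1 = u.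
Proof.
move=> /in_rectP[sf _] fuv; apply/eqP; rewrite eqn_leq; apply/andP; split.
  by case: (size f) sf.
suff : (u < size f)%N by case: (size f).
by rewrite ltnNge; apply: contra fuv => le; rewrite [f`_u]nth_default ?coef0.
Qed.

Lemma deg_evalp (beta : {poly C}) W :
  (size ((map_poly (polyC \o polyC) beta).[W])).-1 = ((size beta).-1 * (size W).-1)%N.
Proof.
rewrite map_poly_comp -[_.[W]]/((map_poly polyC beta) \Po W) size_comp_poly.
by rewrite size_map_polyC.
Qed.

End Rectangles.

Section Bridge.
Variable R : realType.
Local Notation C := (complex R).
Implicit Types (F G Q W P : bipoly R).

Lemma supp_in_rect u v F : supp F `<=` Rect u%:R v%:R -> in_rect u v F.
Proof.
move=> sF i j Fij; have /sF : supp F (i%:R, j%:R) by exists i, j.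
by rewrite /Rect /box /= !ler0n !ler_nat.
Qed.

Lemma Rmn_in_rect m n F : Rmn m n F -> in_rect m n F /\ bicoef F m n = 1.
Proof.
move=> [NF F1]; split=> //; apply: supp_in_rect; rewrite -NF.
by move=> p Fp; apply: sub_gen_smallest; left.
Qed.

Lemma pre_generator_coef a m n F Q : (0 < a)%N -> pre_generator a m n F Q ->
  forall i j, (i <= m)%N -> (j <= n)%N -> (a.-1 * m <= a * i)%N -> (a.-1 * n <= a * j)%N ->
  bicoef (F - Q ^+ a) i j = 0.
Proof.
move=> a0 [_ _ disj] i j im jn li lj; apply/eqP/negPn/negP => ne0.
have ar : 0 < a%:R :> R by rewrite ltr0n.
have bound (x y : nat) : (a.-1 * x <= a * y)%N -> (a%:R - 1) / a%:R * x%:R <= y%:R :> R.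
  move=> le; have -> : a%:R - 1 = a.-1%:R :> R by rewrite -subn1 natrB.
  by rewrite mulrAC ler_pdivrMr // -!natrM ler_nat [(y * _)%N]mulnC.
suff : set0 ((i%:R, j%:R) : plane R) by [].
rewrite -disj; split; first by exists i, j.
by rewrite /box /= !ler_nat im jn !bound.
Qed.

Lemma evalp_wide N (beta : {poly C}) W : (size beta <= N)%N ->
  evalp beta W = \sum_(k < N) (beta`_k)%:P%:P * W ^+ k.
Proof.
move=> sb; rewrite /evalp (horner_coef_wide _ (leq_trans (size_poly _ _) sb)).
by apply: eq_bigr => k _; rewrite coef_map_id0.
Qed.

(** Both kinds of remainders at once: the inner polynomial is the case [W = Q],
    [beta = 'X], [e = 0].  The hypothesis on the support of [F - Q ^+ a] passes to
    [P] because [W ^+ j] has degree less than [(a - 1) m / a] in [x]. *)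
Lemma innermost_corner a b delta m n (beta : {poly C}) F G Q W P (e : 'I_(a.-1 * delta) -> C) :
  quadQ a b m n -> (m <= n)%N -> (n < m + a + b)%N ->
  Rmn m n F -> Rmn (b * (m %/ a)) (b * (n %/ a)) G ->
  (exists c : C, jacobian F G = biconst c) ->
  pre_generator a m n F Q -> (0 < delta)%N ->
  beta \is monic -> size beta = delta.+1 -> Q = evalp beta W ->
  bicoef W (m %/ (a * delta)) (n %/ (a * delta)) != 0 ->
  P = F - Q ^+ a - \sum_j biconst (e j) * W ^+ j -> P != 0 ->
  exists i j, [/\ bicoef P i j != 0, in_rect i j P & (m * j = n * i)%N].
Proof.
move=> [[a0 b0 m0 n0] [am an cab /andP[a2 ab]]] mn narrow /Rmn_in_rect[rF F1] /Rmn_in_rect[rG G1].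
move=> [c J] pg delta0 mb sb eQ Wc eP P0.
have [sQ Q1 _] := pg; have rQ := supp_in_rect sQ.
have Qc : Q`_(m %/ a)`_(n %/ a) != 0 by rewrite -/(bicoef Q _ _) Q1 oner_neq0.
have xQ : (m %/ a = delta * (size W).-1)%N.
  by rewrite -(in_rect_corner rQ Qc) eQ deg_evalp sb.
have yQ : (n %/ a = delta * (size (swapXY W)).-1)%N.
  rewrite -(in_rect_corner (in_rect_swap rQ)) ?coef_swapXY // eQ.
  have -> : swapXY (evalp beta W) = evalp beta (swapXY W).
    rewrite !(@evalp_wide delta.+1) ?sb // rmorph_sum /=; apply: eq_bigr => k _.
    by rewrite rmorphM rmorphXn /= swapXY_const.
  by rewrite deg_evalp sb.
set nu := (size W).-1 in xQ; set om := (size (swapXY W)).-1 in yQ.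
have ad0 : (0 < a * delta)%N by rewrite muln_gt0 a0.
have mE : m = (a * delta * nu)%N by rewrite -mulnA -xQ mulnC divnK.
have nE : n = (a * delta * om)%N by rewrite -mulnA -yQ mulnC divnK.
have nu0 : (0 < nu)%N by move: m0; rewrite mE muln_gt0 => /andP[].
have om0 : (0 < om)%N by move: n0; rewrite nE muln_gt0 => /andP[].
have rW : in_rect nu om W.
  apply/in_rectP; split; first exact: leqSpred.
  move=> i; apply/leq_sizeP => j lj; rewrite -coef_swapXY.
  by rewrite [(swapXY W)`_j]nth_default ?coef0 // (leq_trans (leqSpred _)).
have Wc' : W`_nu`_om != 0.
  by move: Wc; rewrite {1}mE {1}nE !mulKn.
pose B := beta ^+ a + \sum_(j < a.-1 * delta) e j *: 'X^j.
have lt_d : (a.-1 * delta < a * delta)%N by rewrite ltn_pmul2r // ltn_predL.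
have sba : size (beta ^+ a) = (a * delta).+1.
  have := size_exp beta a; rewrite sb /= mulnC => <-.
  by rewrite prednK // size_poly_gt0 expf_neq0 // monic_neq0.
have sS : (size (\sum_(j < a.-1 * delta) e j *: 'X^j)%R <= a * delta)%N.
  rewrite (leq_trans (size_sum _ _ _)) //; apply/bigmax_leqP => j _.
  rewrite (leq_trans (size_scale_leq _ _)) // size_polyXn.
  by rewrite (leq_trans _ lt_d) // ltnS ltnW.
have B1 : B`_(a * delta) = 1.
  rewrite coefD [X in _ + X]nth_default // addr0.
  by have := lead_coefE (beta ^+ a); rewrite sba /= => <-; apply/monicP/monic_exp.
have sB : (size B <= (a * delta).+1)%N.
  by rewrite (leq_trans (size_polyD _ _)) // geq_max sba leqnn ltnW.
have eB : evalp B W = Q ^+ a + \sum_j biconst (e j) * W ^+ j.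
  have ev_morph : forall p, evalp p W = (map_poly polyC p) \Po W.
    by move=> p; rewrite /evalp map_poly_comp.
  rewrite ev_morph /B !rmorphD !rmorphXn /= -ev_morph -eQ; congr (_ + _).
  rewrite !rmorph_sum /=; apply: eq_bigr => j _.
  by rewrite -ev_morph /evalp map_polyZ /= map_polyXn hornerZ hornerXn.
have eF : F = \sum_(k < (a * delta).+1) (B`_k)%:P%:P * W ^+ k + P.
  by rewrite -(evalp_wide _ sB) eB eP; ring.
have rS i j : (\sum_j biconst (e j) * W ^+ j)`_i`_j != 0 ->
    ((a * i < a.-1 * m) && (a * j < a.-1 * n))%N.
  move=> ne0; have [k ek] : exists k : 'I_(a.-1 * delta), (W ^+ k)`_i`_j != 0.
    apply/existsP; move: ne0; apply: contraR; rewrite negb_exists => /forallP all0.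
    rewrite coef_sum coef_sum big1 // => k _.
    by rewrite coefCM coefCM (eqP (negPn (all0 k))) mulr0.
  have /andP[li lj] := in_rectX rW ek.
  have scale x y : (0 < y -> x <= k * y -> a * x < a.-1 * (a * delta * y))%N.
    move=> y0 le; rewrite (_ : a.-1 * (a * delta * y) = a * (a.-1 * delta * y))%N; last by ring.
    by rewrite ltn_pmul2l // (leq_ltn_trans le) // ltn_pmul2r.
  by rewrite mE nE !scale.
have rP : in_rect m n P.
  have rQa : in_rect m n (Q ^+ a).
    by have := @in_rectX _ _ _ _ a rQ; rewrite ![(a * _)%N]mulnC !divnK.
  move=> i j; rewrite eP !coefB => ne0; apply/negPn/negP => out.
  have z (f : bipoly R) : in_rect m n f -> f`_i`_j = 0.
    by move=> r; apply/eqP; apply: contraNT out => /r.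
  move: ne0; rewrite (z F) // (z (Q ^+ a)) // z ?subr0 ?eqxx // => x y /rS /andP[lx ly].
  apply/andP; split; rewrite -(leq_pmul2l a0) ltnW //.
    by rewrite (leq_trans lx) // leq_mul2r leq_pred orbT.
  by rewrite (leq_trans ly) // leq_mul2r leq_pred orbT.
have low i j : P`_i`_j != 0 -> (a * i < a.-1 * m)%N || (a * j < a.-1 * n)%N.
  move=> Pij; have /andP[im jn] := rP _ _ Pij.
  apply: contraNT Pij; rewrite negb_or -!leqNgt => /andP[li lj].
  have -> : P`_i`_j = bicoef (F - Q ^+ a) i j - (\sum_j biconst (e j) * W ^+ j)`_i`_j.
    by rewrite eP /bicoef !coefB.
  rewrite (pre_generator_coef a0 pg) // sub0r oppr_eq0.
  by apply: contraLR li => /rS /andP[lx _]; rewrite -ltnNge.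
have J' : F^`() * map_poly (@deriv C) G - map_poly (@deriv C) F * G^`() = c%:P%:P := J.
rewrite xQ yQ in rG G1.
have Gc : G`_(b * (delta * nu))`_(b * (delta * om)) != 0.
  by rewrite -/(bicoef G _ _) G1 oner_neq0.
rewrite mE nE in mn narrow rF rP low |- *.
exact: (remainder_corner a0 b0 cab delta0 nu0 om0 mn narrow B1 eF rW Wc' rF rG Gc J' rP P0 low).
Qed.

End Bridge.

(** * The Newton polygon *)

Section Geometry.
Variable R : realType.

Lemma Rect_convex (u v : R) : @convex_set R (plane R) (Rect u v).
Proof.
move=> /= p q t; rewrite !inE.
move=> /andP[/andP[p0 pu] /andP[p0' pv]] /andP[/andP[q0 qu] /andP[q0' qv]].
have t0 : 0 <= t%:num :> R by [].
have t1 : 0 <= 1 - t%:num :> R by rewrite subr_ge0.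
have seg (x y z : R) : 0 <= x -> x <= z -> 0 <= y -> y <= z ->
    0 <= t%:num * x + (1 - t%:num) * y <= z.
  move=> x0 xz y0 yz; rewrite addr_ge0 ?mulr_ge0 //=.
  rewrite [leRHS](_ : z = t%:num * z + (1 - t%:num) * z); last by ring.
  by rewrite lerD // ler_wpM2l.
by apply/andP; split; apply: seg.
Qed.

Lemma newton_corner (P : bipoly R) (i j : nat) : bicoef P i j != 0 -> in_rect i j P ->
  [/\ NE_vertex (newton P) (i%:R, j%:R), EN_vertex (newton P) (i%:R, j%:R) &
      newton0 P `<=` Rect i%:R j%:R].
Proof.
move=> Pij rP; have sP : supp P `<=` Rect i%:R j%:R.
  by move=> _ [k [l [/rP/andP[ki lj] ->]]]; rewrite /Rect /box /= !ler0n !ler_nat ki lj.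
have N0 : newton0 P `<=` Rect i%:R j%:R.
  apply: smallest_sub; first exact: Rect_convex.
  by move=> p [/sP //| ->]; rewrite /Rect /box /= lexx !ler0n.
have N : newton P `<=` Rect i%:R j%:R by apply: smallest_sub => //; exact: Rect_convex.
have V : vertex (newton P) (i%:R, j%:R).
  split; first by apply: sub_gen_smallest; exists i, j.
  move=> [q1 q2] [r1 r2] t.
  move=> /N/andP[/= /andP[_ q1i] /andP[_ q2j]] /N/andP[/= /andP[_ r1i] /andP[_ r2j]].
  move=> /andP[t0 t1] [e1 e2].
  have eq_top (x y z : R) : z = t * x + (1 - t) * y -> x <= z -> y <= z -> x = z /\ y = z.
    move=> e xz yz; have t1' : 0 < 1 - t by rewrite subr_gt0.
    have e0 : t * (z - x) + (1 - t) * (z - y) = 0 by rewrite [z in z - x]e [z in z - y]e; ring.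
    have hx : 0 <= t * (z - x) by rewrite mulr_ge0 ?subr_ge0 // ltW.
    have hy : 0 <= (1 - t) * (z - y) by rewrite mulr_ge0 ?subr_ge0 // ltW.
    move/eqP: e0; rewrite paddr_eq0 // !mulf_eq0 (gt_eqF t0) (gt_eqF t1') /= !subr_eq0.
    by move=> /andP[/eqP -> /eqP ->].
  by have [-> ->] := eq_top _ _ _ e1 q1i r1i; have [-> ->] := eq_top _ _ _ e2 q2j r2j.
split=> //; split=> // q [/N/andP[/andP[_ qi] /andP[_ qj]] _]; split=> // _.
Qed.

Lemma narrow_of_ratio (a b m n : nat) : (0 < a)%N ->
  b%:R / a%:R > (n%:R - m%:R) / a%:R - 1 :> R -> (n < m + a + b)%N.
Proof.
move=> a0 hyp; have ar : 0 < a%:R :> R by rewrite ltr0n.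
move: hyp; rewrite ltrBlDr -[X in _ < _ + X](divff (lt0r_neq0 ar)) -mulrDl.
rewrite ltr_pM2r ?invr_gt0 // ltrBlDr -!natrD ltr_nat.
by rewrite [(b + a)%N]addnC addnC addnA.
Qed.

End Geometry.

Theorem corollary5p11 (R : realType) (a b m n : nat) (F G P : bipoly R) :
  quadQ a b m n ->
  (m <= n)%N ->
  Rmn m n F ->
  Rmn (b * (m %/ a)) (b * (n %/ a)) G ->
  (exists c : R[i], jacobian F G = biconst c) ->
  b%:R / a%:R > (n%:R - m%:R) / a%:R - 1 :> R ->
  innermost_polynomial a m n F P \/ inner_polynomial a m n F P ->
  P != 0 ->
  exists m' n' : R,
    [/\ NE_vertex (newton P) (m', n'),
        EN_vertex (newton P) (m', n'),
        m%:R * n' = n%:R * m' &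
        newton0 P `<=` Rect m' n'].
Proof.
move=> qQ mn RF RG J hyp cases P0.
have a0 : (0 < a)%N by case: qQ => -[].
have narrow := narrow_of_ratio a0 hyp.
suff [i [j [Pij rP eij]]] : exists i j,
    [/\ bicoef P i j != 0, in_rect i j P & (m * j = n * i)%N].
  have [NE EN N0] := newton_corner Pij rP.
  by exists i%:R, j%:R; split=> //; rewrite -!natrM eij.
case: cases => [[W [Q [delta [e [[pg _ _ [beta [[mb sb _] eQ sd W1]]] eP _]]]]]|[Q pg eP]].
  have d0 : (0 < delta)%N by rewrite -sd -ltnS prednK // ltnW.
  apply: (innermost_corner qQ mn narrow RF RG J pg d0 mb _ eQ _ eP P0).
    by rewrite -sd prednK // ltnW.
  by rewrite W1 oner_neq0.
apply: (@innermost_corner R a b 1 m n 'X F G Q Q P (fun _ => 0)) => //.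
- exact: monicX.
- exact: size_polyX.
- by rewrite /evalp map_polyX hornerX.
- by case: pg => _ Q1 _; rewrite muln1 Q1 oner_neq0.
- rewrite big1 ?subr0 // => j _.
  by rewrite /biconst !polyC0 mul0r.
Qed.
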